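(* Consider the alignment problem with $m\ge2$ ($m$ fixed) Erdős–Rényi graphs with parameters $p,s$ possibly depending on $n$, as defined in the context. Suppose that $ps=o(1)$ and let $\epsilon>0$ be fixed. If $$nps\big(1-(1-s)^{m-1}\big)(1-\sqrt p)^2\le(1-\epsilon)\log n,$$ then exact alignment is impossible. (It follows that if $nps^2(1-\sqrt p)^2\le\frac{(1-\epsilon)\log n}{m-1}$, then exact alignment is impossible.)
   Context: Let $\mathcal{E}_n=\binom{[n]}{2}$ and $\mathfrak{S}_n$ the set of permutations of $[n]$, acting on $\mathcal{E}_n$ by $\tau(\{i,j\})=\{\tau(i),\tau(j)\}$. An alignment is an $m$-tuple $\pi=(\pi_1,\dots,\pi_m)$ of permutations with $\pi_1=\mathrm{Id}$. The observation $X=(X^1,\dots,X^m)$ consists of $m$ symmetric $\{0,1\}$-valued $n\times n$ matrices with zero diagonal. Under $\mathsf{P}$ there is a uniformly distributed random alignment $\pi^\star$ and, conditioned on $\pi^\star$, $X^k_{\pi^\star_k(e)}=X^0_e\,\xi^k_e$ for $e\in\mathcal{E}_n$, $1\le k\le m$, where $X^0_e\sim\mathrm{Bern}(p)$ and $\xi^k_e\sim\mathrm{Bern}(s)$ are all mutually independent. Overlap: $\mathrm{ov}(\pi,\pi')=\frac1n|\{i\in[n]:\pi_k(i)=\pi'_k(i)\text{ for all }2\le k\le m\}|$. An estimator $\hat\pi=\hat\pi(X)$ achieves exact alignment if $\mathsf{P}(\mathrm{ov}(\pi^\star,\hat\pi)=1)=1-o(1)$ as $n\to\infty$; exact alignment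 is impossible if no estimator achieves it. *)

(* Defs.v *)
From HB Require Import structures.
From mathcomp Require Import all_boot all_order all_algebra all_fingroup.
From mathcomp Require Import all_classical all_reals all_analysis.
Set Implicit Arguments. Unset Strict Implicit. Unset Printing Implicit Defensive.
Import Order.TTheory GRing.Theory Num.Theory numFieldNormedType.Exports.
Local Open Scope ring_scope.

(* Vertices and graphs are 0-indexed: [n] is 'I_n, and the graph index k of
   {1, ..., m} is the ordinal k - 1 of 'I_m. *)

Definition edge (n : nat) := {e : {set 'I_n} | #|e| == 2}.

Lemma edge_act_subproof (n : nat) (tau : 'S_n) (e : edge n) :
  #|tau @: val e| == 2.
Proof. by rewrite card_imset ?(valP e)//; exact: perm_inj. Qed.

Definition edge_act (n : nat) (tau : 'S_n) (e : edge n) : edge n :=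
  exist _ (tau @: val e) (edge_act_subproof tau e).

Definition alignment (m n : nat) :=
  {al : {ffun 'I_m -> 'S_n} |
    [forall k : 'I_m, (val k == 0)%N ==> (al k == 1%g)]}.

Definition align_perm (m n : nat) (al : alignment m n) (k : 'I_m) : 'S_n :=
  val al k.

(* A point of the sample space is a triple (pistar, X0, xi). *)
Definition sample (m n : nat) : finType :=
  (alignment m n * {ffun edge n -> bool} * {ffun 'I_m * edge n -> bool})%type.

Definition pistar (m n : nat) (w : sample m n) : alignment m n := w.1.1.
Definition parent (m n : nat) (w : sample m n) (e : edge n) : bool := w.1.2 e.
Definition keep (m n : nat) (w : sample m n) (k : 'I_m) (e : edge n) : bool :=
  w.2 (k, e).

Definition observation (m n : nat) := {ffun 'I_m -> 'M[bool]_n}.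

(* See obs_edge, obs_sym and obs_diag for the defining relations of X. *)
Definition obs (m n : nat) (w : sample m n) : observation m n :=
  [ffun k => \matrix_(i, j)
     [exists e : edge n,
        [&& val (edge_act (align_perm (pistar w) k) e) == [set i; j]%SET,
            parent w e & keep w k e]]].

Lemma obs_edge (m n : nat) (w : sample m n) (k : 'I_m) (e : edge n) (i j : 'I_n) :
  val (edge_act (align_perm (pistar w) k) e) = [set i; j]%SET ->
  obs w k i j = parent w e && keep w k e.
Proof.
move=> eij; rewrite ffunE mxE -eij; apply/existsP/idP => [[f]|wk].
  case/andP => /eqP /(imset_inj (@perm_inj _ _)) /val_inj -> //.
by exists e; rewrite eqxx.
Qed.

Lemma obs_sym (m n : nat) (w : sample m n) (k : 'I_m) (i j : 'I_n) :
  obs w k i j = obs w k j i.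
Proof. by rewrite !ffunE !mxE finset.setUC. Qed.

Lemma obs_diag (m n : nat) (w : sample m n) (k : 'I_m) (i : 'I_n) :
  obs w k i i = false.
Proof.
rewrite ffunE mxE; apply/existsP => -[e /andP[/eqP ei _]].
have := valP (edge_act (align_perm (pistar w) k) e).
by rewrite ei finset.setUid cards1.
Qed.

(* Joint law: pistar uniform, X0_e ~ Bern(p), xi^k_e ~ Bern(s), all mutually
   independent. *)
Definition law (R : realType) (m n : nat) (p s : R) (w : sample m n) : R :=
  #|{: alignment m n}|%:R^-1
  * \prod_(e : edge n) bernoulli_pmf p (parent w e)
  * \prod_(ke : 'I_m * edge n) bernoulli_pmf s (keep w ke.1 ke.2).

Definition prob (R : realType) (m n : nat) (p s : R) (A : pred (sample m n)) : R :=
  \sum_(w | A w) law p s w.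

Lemma sum_bern_prod (R : realType) (T : finType) (q : R) :
  \sum_(f : {ffun T -> bool}) \prod_(t : T) bernoulli_pmf q (f t) = 1.
Proof.
rewrite -(bigA_distr_bigA (fun _ : T => bernoulli_pmf q)) big1// => t _.
by rewrite big_bool /bernoulli_pmf /= addrC subrK.
Qed.

Lemma prob_total (R : realType) (m n : nat) (p s : R) :
  prob p s (predT : pred (sample m n)) = 1.
Proof.
rewrite /prob /law.
rewrite -(pair_bigA _ (fun (a : alignment m n * {ffun edge n -> bool})
   (x : {ffun 'I_m * edge n -> bool}) => #|{: alignment m n}|%:R^-1
  * \prod_(e : edge n) bernoulli_pmf p (a.2 e)
  * \prod_(ke : 'I_m * edge n) bernoulli_pmf s (x (ke.1, ke.2))))/=.
under eq_bigr => a _.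
  rewrite -big_distrr /=.
  under eq_bigr => x _ do under eq_bigr => ke _ do rewrite -surjective_pairing.
  rewrite sum_bern_prod mulr1; over.
rewrite -(pair_bigA _ (fun (a : alignment m n) (x : {ffun edge n -> bool}) =>
  #|{: alignment m n}|%:R^-1 * \prod_(e : edge n) bernoulli_pmf p (x e)))/=.
under eq_bigr => a _ do rewrite -big_distrr /= sum_bern_prod mulr1.
rewrite sumr_const -[LHS]mulr_natr mulVf// pnatr_eq0 -lt0n.
have h : [forall k : 'I_m, (val k == 0)%N ==>
  ([ffun=> 1%g] k == (1%g : 'S_n))] by apply/forallP => k; rewrite ffunE eqxx implybT.
by apply/card_gt0P; exists (exist _ [ffun=> 1%g] h).
Qed.

Definition ov (R : realType) (m n : nat) (al al' : alignment m n) : R :=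
  #|[set i : 'I_n | [forall k : 'I_m, (0 < val k)%N ==>
       (align_perm al k i == align_perm al' k i)]]%SET|%:R / n%:R.

Definition estimator (m n : nat) := observation m n -> alignment m n.

Local Open Scope classical_set_scope.

Definition achieves_exact_alignment (R : realType) (m : nat) (p s : nat -> R)
    (est : forall n, estimator m n) : Prop :=
  prob (p n) (s n) (fun w : sample m n => ov R (pistar w) (est n (obs w)) == 1)
    @[n --> \oo] --> (1 : R).

Definition exact_alignment_impossible (R : realType) (m : nat)
    (p s : nat -> R) : Prop :=
  ~ exists est : forall n, estimator m n, achieves_exact_alignment p s est.

(* Main.v *)
Require Import Defs.
From HB Require Import structures.
From mathcomp Require Import all_boot all_order all_algebra all_fingroup.
From mathcomp Require Import all_classical all_reals all_analysis.
From mathcomp Require Import ring lra.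
Import Order.TTheory GRing.Theory Num.Theory numFieldNormedType.Exports.

(** Single out one graph other than the first, and label every edge [e] of the
    parent by the pair [(a, b)] of its bit [a] in that graph and the vector [b]
    of its bits in the other graphs. Given the alignment, the labels are
    independent with a common law [g], and the observation is a function of the
    alignment and the labels. Composing the alignment of the singled out graph
    with a transposition [(i j)] and permuting the bits [a] accordingly gives
    another alignment and other labels with the same observation. When these
    labels are at least as likely as the true ones, no estimator can tell the
    two explanations apart to its advantage: the probability that such a
    transposition exists is at most twice the failure probability of any
    estimator ([transposable_le_failure]). It remains to bound the former below
    by a positive constant.

    A transposition [(i j)] compares the rows [(a_il, b_il)], [(a_jl, b_jl)] with
    the rows in which [a_il] and [a_jl] are exchanged. Let [M] be the matrix of
    the [sqrt (g (a, b))], with two rows; [M M^T] has trace 1, and [kappa] denotes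
    its determinant. The sum of the geometric means of the two likelihoods is,
    per column [l], the trace of [(M M^T) ^ 2], that is [1 - 2 kappa]
    ([pair_affinity]); for two transpositions [(i j)] and [(i k)] sharing a vertex
    one finds likewise the trace of [(M M^T) ^ 3], that is [1 - 3 kappa]
    ([triple_affinity]). Hence over [N] columns two transpositions sharing a vertex
    both gain with probability at most [(1 - 3 kappa) ^ N]
    ([double_swap_prob_ub]), while one transposition gains with probability at
    least [(1 - 2 kappa) ^ N] up to a factor [exp (- O (sqrt (N kappa)))]: under
    the normalized geometric mean of the two likelihoods the log-likelihood
    ratio is symmetric, with variance [O (N kappa)], and Jensen's inequality
    applies ([affinity_prob_lb]).

    If [n kappa <= (1 - delta) ln n], these two estimates make a second moment
    argument work over the pairs of [S1 * S2], where [S1] and [S2] are disjoint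
    sets of about [n / ln n] vertices. Rows are compared separately on the
    columns outside [S1] and [S2], where the rows of distinct vertices are
    independent and disjoint pairs therefore uncorrelated, and on the columns
    inside, which are so few that the inside gain has probability bounded below
    ([transposable_second_moment], [transposable_prob_lb]).

    Finally [kappa = p s q (sqrt (1 - p + u) - sqrt u) ^ 2], where
    [q = 1 - (1 - s) ^ (m - 1)] and [u = p (1 - s) ^ m] ([kappa_letter_law]).
    Since [p - u <= m p s] tends to 0, this is
    [p s q (1 - sqrt p) ^ 2 (1 + o(1))] ([kappa_threshold]), so that the assumed
    inequality bounds [n kappa] as required. *)

Set Implicit Arguments. Unset Strict Implicit. Unset Printing Implicit Defensive.
Local Open Scope ring_scope.

(** * Finite product measures *)

(** The expectation of [F] over independent coordinates of law [g]. The weights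
    [g] are not assumed to sum to 1: geometric means of two laws occur too. *)
Definition Ex (R : realType) (I V : finType) (g : V -> R)
    (F : {ffun I -> V} -> R) : R :=
  \sum_(Y : {ffun I -> V}) (\prod_(e : I) g (Y e)) * F Y.

Lemma prod_indicator (R : realType) (J : finType) (P : pred J) :
  \prod_(j : J) (P j)%:R = [forall j, P j]%:R :> R.
Proof.
have [/forallP h|/forallPn[j nPj]] := boolP [forall j, P j].
  by rewrite big1// => j _; rewrite h.
by rewrite (bigD1 j)//= (negbTE nPj) mul0r.
Qed.

Lemma Ex_prod (R : realType) (I V : finType) (g : V -> R) (F : I -> V -> R) :
  Ex g (fun Y => \prod_e F e (Y e)) = \prod_e \sum_v g v * F e v.
Proof.
rewrite bigA_distr_bigA; apply: eq_bigr => Y _.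
by rewrite -big_split.
Qed.

Lemma Ex_ge0 (R : realType) (I V : finType) (g : V -> R) (F : {ffun I -> V} -> R) :
  (forall v, 0 <= g v) -> (forall Y, 0 <= F Y) -> 0 <= Ex g F.
Proof.
by move=> g0 F0; apply: sumr_ge0 => Y _; rewrite mulr_ge0// prodr_ge0.
Qed.

Lemma ler_Ex (R : realType) (I V : finType) (g : V -> R)
    (F G : {ffun I -> V} -> R) :
  (forall v, 0 <= g v) -> (forall Y, F Y <= G Y) -> Ex g F <= Ex g G.
Proof.
by move=> g0 FG; apply: ler_sum => Y _; rewrite ler_wpM2l// prodr_ge0.
Qed.

Lemma eq_Ex (R : realType) (I V : finType) (g : V -> R)
    (F G : {ffun I -> V} -> R) : F =1 G -> Ex g F = Ex g G.
Proof. by move=> FG; apply: eq_bigr => Y _; rewrite FG. Qed.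

Lemma Ex_sum (R : realType) (I V : finType) (g : V -> R) (J : finType)
    (P : pred J) (F : J -> {ffun I -> V} -> R) :
  Ex g (fun Y => \sum_(j | P j) F j Y) = \sum_(j | P j) Ex g (F j).
Proof.
rewrite /Ex exchange_big; apply: eq_bigr => Y _ /=.
by rewrite mulr_sumr.
Qed.

Lemma ExZ (R : realType) (I V : finType) (g : V -> R) (c : R)
    (F : {ffun I -> V} -> R) : Ex g (fun Y => c * F Y) = c * Ex g F.
Proof. by rewrite /Ex mulr_sumr; apply: eq_bigr => Y _; rewrite mulrCA. Qed.

Lemma Ex_cst (R : realType) (I V : finType) (g : V -> R) (c : R) :
  \sum_v g v = 1 -> Ex g (fun _ : {ffun I -> V} => c) = c.
Proof.
move=> g1; rewrite /Ex -mulr_suml -(bigA_distr_bigA (fun _ : I => g)).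
by rewrite big1 ?mul1r.
Qed.

Lemma Ex_cauchy (R : realType) (I V : finType) (g : V -> R)
    (F G : {ffun I -> V} -> R) :
  (forall v, 0 <= g v) ->
  Ex g (fun Y => F Y * G Y) ^+ 2 <=
  Ex g (fun Y => F Y ^+ 2) * Ex g (fun Y => G Y ^+ 2).
Proof.
move=> g0; set W := fun Y : {ffun I -> V} => \prod_e g (Y e).
have W0 Y : 0 <= W Y by rewrite prodr_ge0.
set a := Ex _ _; set b := Ex _ _; set c := Ex _ _.
have quad t : 0 <= b * t ^+ 2 - a * t *+ 2 + c.
  have -> : b * t ^+ 2 - a * t *+ 2 + c =
      \sum_Y W Y * (F Y * t - G Y) ^+ 2.
    rewrite /a /b /c /Ex -mulrnAr !mulr_suml -sumrB -big_split/=.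
    by apply: eq_bigr => Y _; rewrite -/(W Y); ring.
  by apply: sumr_ge0 => Y _; rewrite mulr_ge0// sqr_ge0.
have b0 : 0 <= b by apply: Ex_ge0 => // Y; rewrite sqr_ge0.
have c0 : 0 <= c by apply: Ex_ge0 => // Y; rewrite sqr_ge0.
have [b_eq0|b_neq0] := eqVneq b 0.
  have [->|a_neq0] := eqVneq a 0; first by rewrite expr0n/= mulr_ge0.
  have := quad ((c + 1) / (2 * a)); rewrite b_eq0 mul0r add0r.
  have -> : a * ((c + 1) / (2 * a)) *+ 2 = c + 1 by field.
  lra.
have := quad (a / b).
have -> : b * (a / b) ^+ 2 - a * (a / b) *+ 2 + c = (b * c - a ^+ 2) / b by field.
by rewrite pmulr_lge0 ?subr_ge0// invr_gt0 lt_def b_neq0.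
Qed.

(** Prescribing the coordinates along an injection costs exactly the product of
    their masses: each coordinate contributes either one factor or a total
    mass. *)
Lemma Ex_cylinder (R : realType) (I V J : finType) (g : V -> R) (iota : J -> I)
    (y : {ffun J -> V}) :
  \sum_v g v = 1 -> injective iota ->
  Ex g (fun Y => ([ffun j => Y (iota j)] == y)%:R) = \prod_j g (y j).
Proof.
move=> g1 inj_iota.
pose F e v : R := \prod_(j | iota j == e) (v == y j)%:R.
have -> : Ex g (fun Y => ([ffun j => Y (iota j)] == y)%:R) =
    Ex g (fun Y => \prod_e F e (Y e)).
  apply: eq_Ex => Y; rewrite /F.
  have -> : ([ffun j => Y (iota j)] == y) = [forall j, Y (iota j) == y j].
    apply/eqP/forallP => [<- j|h]; first by rewrite ffunE.
    by apply/ffunP => j; rewrite ffunE; apply/eqP.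
  rewrite -prod_indicator (partition_big iota xpredT)//=.
  by apply: eq_bigr => e _; apply: eq_bigr => j /eqP ->.
rewrite Ex_prod [RHS](partition_big iota xpredT)//=.
apply: eq_bigr => e _; rewrite /F.
have [j /eqP ej|noj] := pickP (fun j => iota j == e).
  have one : (fun k => iota k == e) =1 pred1 j.
    by move=> k /=; rewrite -ej (inj_eq inj_iota).
  rewrite (eq_bigl _ _ one) big_pred1_eq.
  under eq_bigr => v _ do rewrite (eq_bigl _ _ one) big_pred1_eq.
  rewrite (bigD1 (y j))//= eqxx mulr1 big1 ?addr0// => v /negbTE ->.
  by rewrite mulr0.
rewrite [RHS]big_pred0//.
under eq_bigr => v _ do rewrite big_pred0// mulr1.
by [].
Qed.

Lemma Ex_indep (R : realType) (I V J1 J2 : finType) (g : V -> R)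
    (i1 : J1 -> I) (i2 : J2 -> I)
    (F1 : {ffun J1 -> V} -> R) (F2 : {ffun J2 -> V} -> R) :
  \sum_v g v = 1 -> injective i1 -> injective i2 ->
  (forall j1 j2, i1 j1 != i2 j2) ->
  Ex g (fun Y => F1 [ffun j => Y (i1 j)] * F2 [ffun j => Y (i2 j)]) =
  Ex g F1 * Ex g F2.
Proof.
move=> g1 inj1 inj2 dis.
pose i12 (j : J1 + J2) := match j with inl j => i1 j | inr j => i2 j end.
have inj12 : injective i12.
  move=> [a|a] [b|b] //= h.
  - by rewrite (inj1 _ _ h).
  - by have := dis a b; rewrite h eqxx.
  - by have := dis b a; rewrite h eqxx.
  - by rewrite (inj2 _ _ h).
have expand (J : finType) (H : {ffun J -> V} -> R) (z : {ffun J -> V}) :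
    H z = \sum_(y : {ffun J -> V}) H y * (z == y)%:R.
  rewrite (bigD1 z)//= eqxx mulr1 big1 ?addr0// => y /negbTE.
  by rewrite eq_sym => ->; rewrite mulr0.
pose y12 (y1 : {ffun J1 -> V}) (y2 : {ffun J2 -> V}) : {ffun J1 + J2 -> V} :=
  [ffun j => match j with inl j => y1 j | inr j => y2 j end].
have -> : Ex g (fun Y => F1 [ffun j => Y (i1 j)] * F2 [ffun j => Y (i2 j)]) =
    Ex g (fun Y => \sum_(y1 : {ffun J1 -> V}) \sum_(y2 : {ffun J2 -> V})
      F1 y1 * F2 y2 * ([ffun j => Y (i12 j)] == y12 y1 y2)%:R).
  apply: eq_Ex => Y; rewrite [F1 _]expand [F2 _]expand mulr_suml.
  apply: eq_bigr => y1 _; rewrite mulr_sumr; apply: eq_bigr => y2 _.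
  rewrite mulrACA -natrM mulnb; congr (_ * (nat_of_bool _)%:R).
  apply/andP/eqP => [[/eqP <- /eqP <-]|h].
    by apply/ffunP => -[j|j]; rewrite !ffunE.
  split; apply/eqP/ffunP => j; first by have /ffunP/(_ (inl j)) := h; rewrite !ffunE.
  by have /ffunP/(_ (inr j)) := h; rewrite !ffunE.
rewrite Ex_sum /Ex mulr_suml; apply: eq_bigr => y1 _.
rewrite -/(Ex g _) Ex_sum mulr_sumr; apply: eq_bigr => y2 _.
rewrite ExZ Ex_cylinder// big_sumType/=.
under eq_bigr => j _ do rewrite ffunE.
under [X in _ * (_ * X)]eq_bigr => j _ do rewrite ffunE.
by ring.
Qed.

Lemma Ex_marginal (R : realType) (I V J : finType) (g : V -> R)
    (iota : J -> I) (F : {ffun J -> V} -> R) :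
  \sum_v g v = 1 -> injective iota ->
  Ex g (fun Y => F [ffun j => Y (iota j)]) = Ex g F.
Proof.
move=> g1 inj_iota; pose i0 (v : void) : I := of_void I v.
have inj0 : injective i0 by move=> [].
have dis j k : iota j != i0 k by case: k.
have := Ex_indep F (fun=> 1) g1 inj_iota inj0 dis.
rewrite (Ex_cst _ 1 g1) mulr1 => <-.
by apply: eq_Ex => Y; rewrite mulr1.
Qed.

(** The encoding [enc] lets the law of a block be written on pairs or triples,
    where single-letter sums are computed, rather than on finite functions. *)
Lemma Ex_block (R : realType) (V K C T : finType) (g : V -> R)
    (enc : T -> {ffun C -> V}) (F : {ffun K * C -> V} -> R) :
  bijective enc ->
  Ex g F =
  Ex (fun t => \prod_c g (enc t c))
    (fun z => F [ffun kc => enc (z kc.1) kc.2]).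
Proof.
move=> [dec encK decK].
rewrite /Ex (reindex (fun z : {ffun K -> T} => [ffun kc => enc (z kc.1) kc.2])).
  apply: eq_bigr => z _; congr (_ * _).
  rewrite [RHS]pair_bigA/=; apply: eq_bigr => kc _.
  by rewrite ffunE.
apply: onW_bij.
exists (fun Y : {ffun K * C -> V} => [ffun k => dec [ffun c => Y (k, c)]]) => [z|Y].
  apply/ffunP => k; rewrite ffunE -[RHS]encK; congr dec.
  by apply/ffunP => c; rewrite !ffunE.
by apply/ffunP => -[k c]; rewrite !ffunE decK ffunE.
Qed.

(** * Likelihood ratios of a product measure against a permuted copy *)

Lemma sqrt_ln_sqr_le (R : realType) (a b : R) : 0 <= a -> 0 <= b ->
  Num.sqrt (a * b) * (ln a - ln b) ^+ 2 <= 16 * (Num.sqrt a - Num.sqrt b) ^+ 2.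
Proof.
wlog ba : a b / b <= a => [wlg|] a0 b0.
  have [/wlg|/ltW /wlg] := leP b a; first exact.
  by rewrite mulrC -[X in _ * X <= _]sqrrN -[X in _ <= _ * X]sqrrN !opprB mulrC;
     rewrite [b * a]mulrC; apply.
have [b_eq0|b_neq0] := eqVneq b 0.
  by rewrite b_eq0 mulr0 sqrtr0 mul0r mulr_ge0// sqr_ge0.
have bgt0 : 0 < b by rewrite lt_def b_neq0.
have agt0 : 0 < a by apply: lt_le_trans ba.
(* Fourth roots: with a = x^4 and b = y^4 the bound ln (x / y) <= x / y - 1
   loses only the factor (x + y)^2 / x^2 <= 4. *)
set x := Num.sqrt (Num.sqrt a); set y := Num.sqrt (Num.sqrt b).
have x0 : 0 < x by rewrite !sqrtr_gt0.
have y0 : 0 < y by rewrite !sqrtr_gt0.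
have sa : Num.sqrt a = x ^+ 2 by rewrite sqr_sqrtr// sqrtr_ge0.
have sb : Num.sqrt b = y ^+ 2 by rewrite sqr_sqrtr// sqrtr_ge0.
have ea : a = x ^+ 4 by rewrite (exprM x 2 2) -sa sqr_sqrtr.
have eb : b = y ^+ 4 by rewrite (exprM y 2 2) -sb sqr_sqrtr.
have yx : y <= x by rewrite ler_wsqrtr// ler_wsqrtr.
rewrite sqrtrM// sa sb.
have -> : ln a - ln b = 4 * ln (x / y).
  rewrite ea eb !lnXn// ln_div ?posrE//; ring.
have ln0 : 0 <= ln (x / y) by rewrite ln_ge0// ler_pdivlMr// mul1r.
have ln1 : ln (x / y) <= x / y - 1.
  have := expR_ge1Dx (x / y - 1); rewrite addrC subrK => h.
  by rewrite -ler_expR lnK ?posrE ?divr_gt0.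
have : y * ln (x / y) <= x - y.
  have -> : x - y = y * (x / y - 1) by field; rewrite gt_eqF.
  by rewrite ler_pM2l.
have : 0 <= y * ln (x / y) by rewrite mulr_ge0// ltW.
have -> : x ^+ 2 * y ^+ 2 * (4 * ln (x / y)) ^+ 2 =
    16 * (x * (y * ln (x / y))) ^+ 2 by ring.
move: (y * _) => t t0 tle.
rewrite ler_pM2l// ler_sqr ?nnegrE ?mulr_ge0 ?(ltW x0)//; last first.
  by rewrite subr_ge0; apply: lerXn2r; rewrite ?nnegrE// ltW.
rewrite subr_sqr mulrC; apply: ler_pM => //; first exact: ltW.
by rewrite lerDl ltW.
Qed.

Lemma sqrt_prod (R : realType) (I : finType) (F : I -> R) :
  (forall i, 0 <= F i) -> \prod_i Num.sqrt (F i) = Num.sqrt (\prod_i F i).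
Proof.
move=> F0; have [] : 0 <= \prod_i F i /\
    \prod_i Num.sqrt (F i) = Num.sqrt (\prod_i F i); last by [].
apply: (big_ind2 (fun x y => 0 <= y /\ x = Num.sqrt y)) => [|a b c d|i _].
- by rewrite sqrtr1.
- by move=> [b0 ->] [d0 ->]; rewrite mulr_ge0// sqrtrM.
- by rewrite F0.
Qed.

Lemma ln_prod (R : realType) (I : finType) (F : I -> R) :
  (forall i, 0 < F i) -> ln (\prod_i F i) = \sum_i ln (F i).
Proof.
move=> F0; have [] : 0 < \prod_i F i /\ ln (\prod_i F i) = \sum_i ln (F i); last by [].
apply: (big_ind2 (fun x y => 0 < x /\ ln x = y)) => [|a b c d|i _].
- by rewrite ln1.
- by move=> [a0 <-] [c0 <-]; rewrite mulr_gt0// lnM.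
- by rewrite F0.
Qed.

Section AffinityLowerBound.
Variables (R : realType) (K T : finType) (f : T -> R) (sigma : T -> T).
Hypotheses (f0 : forall t, 0 <= f t) (f1 : \sum_t f t = 1).
Hypothesis sigmaK : involutive sigma.

Let g t := Num.sqrt (f t * f (sigma t)).
Let d t := ln (f t) - ln (f (sigma t)).
Let Z := \sum_t g t.

Lemma affinity_antisym : \sum_t g t * d t = 0.
Proof.
set S := \sum_t _.
have : S = - S.
  rewrite /S [LHS](reindex_inj (inv_inj sigmaK))/= -sumrN.
  by apply: eq_bigr => t _; rewrite /g /d sigmaK mulrC [f t * _]mulrC; ring.
by move=> h; lra.
Qed.

Lemma affinity_variance : \sum_t g t * d t ^+ 2 <= 32 * (1 - Z).
Proof.
have -> : 32 * (1 - Z) =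
    \sum_t 16 * (Num.sqrt (f t) - Num.sqrt (f (sigma t))) ^+ 2.
  have f1s : \sum_t f (sigma t) = 1.
    by rewrite -f1 [RHS](reindex_inj (inv_inj sigmaK)).
  have -> : 32 * (1 - Z) = 16 * (\sum_t f t + \sum_t f (sigma t) - 2 * Z).
    by rewrite f1 f1s; ring.
  rewrite -mulr_sumr /Z; congr (_ * _).
  rewrite mulr_sumr -sumrN -!big_split/=; apply: eq_bigr => t _.
  by rewrite sqrrB !sqr_sqrtr// /g sqrtrM//; ring.
by apply: ler_sum => t _; exact: sqrt_ln_sqr_le.
Qed.

Let one_at (k : K) (e : K) (v : T) : R := if e == k then d v else 1.

Lemma prod_one_at k (y : {ffun K -> T}) : \prod_e one_at k e (y e) = d (y k).
Proof.
rewrite (bigD1 k)//= /one_at eqxx big1 ?mulr1// => e /negbTE ->.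
by [].
Qed.

(** Under the weights [g] the log-likelihood ratio is a sum of independent
    centred terms, so its cross terms vanish. *)
Lemma affinity_second_moment :
  Ex g (fun y : {ffun K -> T} => (\sum_k d (y k)) ^+ 2) =
  #|K|%:R * (Z ^+ #|K|.-1 * \sum_t g t * d t ^+ 2).
Proof.
have -> : Ex g (fun y : {ffun K -> T} => (\sum_k d (y k)) ^+ 2) =
    \sum_(k : K) \sum_(l : K)
      Ex g (fun y : {ffun K -> T} => \prod_e (one_at k e (y e) * one_at l e (y e))).
  rewrite (@eq_Ex _ _ _ _ _ (fun y : {ffun K -> T} =>
    \sum_k \sum_l \prod_e (one_at k e (y e) * one_at l e (y e)))).
    by rewrite Ex_sum; apply: eq_bigr => k _; rewrite Ex_sum.
  move=> y; rewrite expr2 mulr_suml.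
  apply: eq_bigr => k _; rewrite mulr_sumr; apply: eq_bigr => l _.
  by rewrite big_split/= !prod_one_at.
rewrite (eq_bigr (fun=> Z ^+ #|K|.-1 * \sum_t g t * d t ^+ 2)).
  by rewrite sumr_const mulr_natl.
move=> k _; rewrite (bigD1 k)//= [X in _ + X]big1 ?addr0 => [|l lk].
  rewrite (Ex_prod g (fun e v => one_at k e v * one_at k e v)) (bigD1 k)//= mulrC.
  congr (_ * _).
    rewrite (eq_bigr (fun=> Z)) => [|e /negbTE ek].
      by rewrite prodr_const; congr (_ ^+ _); rewrite cardC1.
    by apply: eq_bigr => t _; rewrite /one_at ek !mulr1.
  by apply: eq_bigr => t _; rewrite /one_at eqxx expr2.
rewrite (Ex_prod g (fun e v => one_at k e v * one_at l e v)) (bigD1 k)//=.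
rewrite [X in X * _](_ : _ = 0) ?mul0r// -[RHS]affinity_antisym.
by apply: eq_bigr => t _; rewrite /one_at eqxx eq_sym (negbTE lk) mulr1.
Qed.

(** Pointwise, [min a c = sqrt (a * c) * exp (- |ln a - ln c| / 2)]; the
    exponential is replaced by a minorant quadratic in the log-ratio, namely
    the tangent line at [- b] composed with [|x| <= b / 2 + x^2 / (2 * b)]. *)
Lemma min_ge_tangent (a c b : R) : 0 < a -> 0 < c -> 0 < b ->
  Num.sqrt (a * c) * (expR (- b) * (1 + b / 2 - (ln a - ln c) ^+ 2 / (8 * b)))
  <= a.
Proof.
move=> a0 c0 b0.
have -> : Num.sqrt (a * c) = expR ((ln a + ln c) / 2).
  apply/eqP; rewrite -(@eqrXn2 _ 2)// ?sqrtr_ge0 ?expR_ge0//.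
  rewrite sqr_sqrtr ?mulr_ge0 ?ltW// -expRM_natr.
  have -> : (ln a + ln c) / 2 * 2%:R = ln a + ln c by field.
  by rewrite expRD !lnK.
set A := ln a; set C := ln c.
rewrite mulrA -expRD; have -> : a = expR A by rewrite lnK.
have := expR_ge1Dx (b / 2 - (A - C) ^+ 2 / (8 * b)).
rewrite addrA => h.
apply: (le_trans (ler_wpM2l (expR_ge0 _) h)).
rewrite -expRD ler_expR -subr_ge0.
have -> : A - ((A + C) / 2 - b + (b / 2 - (A - C) ^+ 2 / (8 * b))) =
    (A - C + 2 * b) ^+ 2 / (8 * b) by field; rewrite gt_eqF.
by rewrite divr_ge0 ?sqr_ge0// mulr_ge0// ltW.
Qed.

(** By the symmetry [sigma], the probability is at least half the sum of the
    pointwise minima of the two likelihoods. The quadratic minorant of these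
    minima is then summed exactly by [affinity_second_moment]. *)
Lemma affinity_prob_lb (b : R) : 0 < b -> 8 * #|K|%:R * (1 - Z) <= b ^+ 2 * Z ->
  Z ^+ #|K| * expR (- b) / 2 <=
  Ex f (fun y : {ffun K -> T} => (\prod_k f (y k) <= \prod_k f (sigma (y k)))%R%:R).
Proof.
move=> b0 hb; set P := Ex _ _.
have g0 t : 0 <= g t by exact: sqrtr_ge0.
have Z0 : 0 <= Z by apply: sumr_ge0.
pose L (y : {ffun K -> T}) := \prod_k f (y k).
pose L' (y : {ffun K -> T}) := \prod_k f (sigma (y k)).
pose D (y : {ffun K -> T}) := \sum_k d (y k).
have L0 y : 0 <= L y by apply: prodr_ge0.
have L'0 y : 0 <= L' y by apply: prodr_ge0.
have minP : \sum_y Num.min (L y) (L' y) <= 2 * P.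
  have -> : 2 * P = \sum_y (L y * (L y <= L' y)%R%:R + L' y * (L' y <= L y)%R%:R).
    rewrite big_split/= mulr_natl mulr2n; congr (_ + _).
    have inj : injective (fun y : {ffun K -> T} => [ffun k => sigma (y k)]).
      move=> y z /ffunP h; apply/ffunP => k; apply: (inv_inj sigmaK).
      by have := h k; rewrite !ffunE.
    rewrite /P /Ex (reindex_inj inj)/=; apply: eq_bigr => y _.
    have -> : \prod_e f ([ffun k => sigma (y k)] e) = L' y.
      by apply: eq_bigr => k _; rewrite ffunE.
    have -> : \prod_k f (sigma ([ffun k => sigma (y k)] k)) = L y.
      by apply: eq_bigr => k _; rewrite ffunE sigmaK.
    by [].
  apply: ler_sum => y _.
  by case: (leP (L y) (L' y)) => h;
    rewrite ?mulr1 ?mulr0 ?addr0 ?add0r ?lerDl ?(ltW h) ?mulr1 ?lerDr ?mulr_ge0 ?ler0n.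
have lb : Ex g (fun y => expR (- b) * (1 + b / 2 - D y ^+ 2 / (8 * b))) <=
    \sum_y Num.min (L y) (L' y).
  apply: ler_sum => y _.
  have [/forallP fpos|/forallPn[k fk]] := boolP [forall k, 0 < f (y k) * f (sigma (y k))].
    have fy k : 0 < f (y k).
      by rewrite lt_def f0 andbT; apply/eqP => h; have := fpos k; rewrite h mul0r ltxx.
    have fsy k : 0 < f (sigma (y k)).
      by rewrite lt_def f0 andbT; apply/eqP => h; have := fpos k; rewrite h mulr0 ltxx.
    have Lp : 0 < L y by apply: prodr_gt0.
    have L'p : 0 < L' y by apply: prodr_gt0.
    have -> : \prod_e g (y e) = Num.sqrt (L y * L' y).
      by rewrite /L /L' -big_split/= sqrt_prod// => k; rewrite mulr_ge0.
    have -> : D y = ln (L y) - ln (L' y).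
      by rewrite /D sumrB !ln_prod.
    rewrite le_min min_ge_tangent//= mulrC -[X in X / (8 * b)]sqrrN opprB.
    by rewrite [L y * _]mulrC mulrC min_ge_tangent.
  have gk : g (y k) = 0 by rewrite /g ler0_sqrtr// leNgt.
  rewrite (bigD1 k)//= gk !mul0r.
  by rewrite le_min L0 L'0.
have : expR (- b) * Z ^+ #|K| <=
    Ex g (fun y => expR (- b) * (1 + b / 2 - D y ^+ 2 / (8 * b))).
  rewrite ExZ ler_wpM2l ?expR_ge0//.
  have -> : Ex g (fun y => 1 + b / 2 - D y ^+ 2 / (8 * b)) =
     (1 + b / 2) * Z ^+ #|K| - Ex g (fun y => D y ^+ 2) / (8 * b).
    have -> : Z ^+ #|K| = \sum_(y : {ffun K -> T}) \prod_e g (y e).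
      by rewrite -(bigA_distr_bigA (fun _ : K => g)) prodr_const.
    rewrite /Ex mulr_suml mulr_sumr -sumrB; apply: eq_bigr => y _; ring.
  rewrite affinity_second_moment mulrDl mul1r -addrA lerDl subr_ge0.
  rewrite ler_pdivrMr; last by rewrite mulr_gt0.
  have -> : b / 2 * Z ^+ #|K| * (8 * b) = 4 * (b ^+ 2 * Z ^+ #|K|) by field.
  have Zk0 : 0 <= Z ^+ #|K|.-1 by exact: exprn_ge0.
  have step : #|K|%:R * (Z ^+ #|K|.-1 * \sum_t g t * d t ^+ 2) <=
     #|K|%:R * (Z ^+ #|K|.-1 * (32 * (1 - Z))).
    by rewrite ler_wpM2l// ler_wpM2l// affinity_variance.
  apply: (le_trans step).
  have := ler_wpM2l Zk0 hb.
  case: #|K| Zk0 {step} => [|N] Zk0 /=;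
    first by rewrite mul0r expr0 mulr1 => _; rewrite mulr_ge0 ?sqr_ge0.
  rewrite (exprSr Z); move: (Z ^+ N) (N.+1%:R) => z c h.
  have -> : c * (z * (32 * (1 - Z))) = 4 * (z * (8 * c * (1 - Z))) by ring.
  have -> : b ^+ 2 * (z * Z) = z * (b ^+ 2 * Z) by ring.
  by rewrite ler_pM2l.
move=> h; rewrite ler_pdivrMr// mulrC [P * 2]mulrC.
by apply: (le_trans h); apply: (le_trans lb).
Qed.

End AffinityLowerBound.

(** * The two- and three-row affinities of a bipartite letter law *)

Lemma sum_pair (R : realType) (I J : finType) (F : I * J -> R) :
  \sum_t F t = \sum_i \sum_j F (i, j).
Proof. by rewrite pair_bigA; apply: eq_bigr => -[]. Qed.

Definition swap_bit (A B : Type) (v w : A * B) : (A * B) * (A * B) :=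
  ((w.1, v.2), (v.1, w.2)).

Definition swap_pair (A B : Type) (t : (A * B) * (A * B)) := swap_bit t.1 t.2.

Definition mass (R : realType) (B : finType) (g : bool * B -> R) (a : bool) : R :=
  \sum_b g (a, b).

(** The determinant of the Gram matrix of the two rows of [sqrt g]. Since that
    matrix has trace 1, its second and third power sums of eigenvalues, which
    are the two affinities below, are [1 - 2 * kappa] and [1 - 3 * kappa]. *)
Definition kappa (R : realType) (B : finType) (g : bool * B -> R) : R :=
  mass g true * mass g false -
  (\sum_b Num.sqrt (g (true, b)) * Num.sqrt (g (false, b))) ^+ 2.

Section LetterAffinity.
Variables (R : realType) (B : finType) (g : bool * B -> R).
Hypotheses (g0 : forall v, 0 <= g v) (g1 : \sum_v g v = 1).

Let V := (bool * B)%type.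

Let gram (a a' : bool) := \sum_b Num.sqrt (g (a, b)) * Num.sqrt (g (a', b)).

Let gramC a a' : gram a a' = gram a' a.
Proof. by apply: eq_bigr => b _; rewrite mulrC. Qed.

Let gram_diag a : gram a a = mass g a.
Proof. by apply: eq_bigr => b _; rewrite -expr2 sqr_sqrtr. Qed.

Lemma mass_total : mass g true + mass g false = 1.
Proof. by rewrite -g1 sum_pair big_bool. Qed.

Definition pair_law (t : V * V) := g t.1 * g t.2.

Definition triple_law (t : V * V * V) := g t.1.1 * g t.1.2 * g t.2.

Lemma pair_law_ge0 t : 0 <= pair_law t. Proof. exact: mulr_ge0. Qed.

Lemma triple_law_ge0 t : 0 <= triple_law t.
Proof. by rewrite !mulr_ge0. Qed.

Lemma pair_law_total : \sum_t pair_law t = 1.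
Proof.
rewrite sum_pair -[RHS]g1; apply: eq_bigr => v _.
by rewrite /pair_law/= -mulr_sumr g1 mulr1.
Qed.

Lemma pair_affinity :
  \sum_t Num.sqrt (pair_law t * pair_law (swap_pair t)) = 1 - 2 * kappa g.
Proof.
have -> : \sum_t Num.sqrt (pair_law t * pair_law (swap_pair t)) =
    \sum_a1 \sum_a2 gram a1 a2 ^+ 2.
  rewrite !sum_pair; apply: eq_bigr => a1 _.
  under eq_bigr => b1 _ do rewrite sum_pair.
  rewrite exchange_big/=; apply: eq_bigr => a2 _.
  rewrite expr2 /gram mulr_suml; apply: eq_bigr => b1 _.
  rewrite mulr_sumr; apply: eq_bigr => b2 _.
  by rewrite /pair_law /= !sqrtrM ?mulr_ge0//; ring.
rewrite !big_bool/= (gramC false true) !gram_diag /kappa -/(gram true false).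
have -> : mass g false = 1 - mass g true by move: mass_total => <-; ring.
by ring.
Qed.

Lemma triple_affinity :
  \sum_(t : V * V * V)
    Num.sqrt ((pair_law (swap_bit t.1.1 t.1.2) * g t.2) *
              (pair_law (swap_bit t.1.1 t.2) * g t.1.2)) = 1 - 3 * kappa g.
Proof.
pose F (t : V * V * V) :=
  Num.sqrt ((pair_law (swap_bit t.1.1 t.1.2) * g t.2) *
            (pair_law (swap_bit t.1.1 t.2) * g t.1.2)).
rewrite -[LHS]/(\sum_t F t).
have -> : \sum_t F t =
    \sum_a1 \sum_a2 \sum_a3 gram a2 a3 * gram a1 a2 * gram a3 a1.
  rewrite !sum_pair; apply: eq_bigr => a1 _.
  under eq_bigr => b1 _ do rewrite sum_pair.
  rewrite exchange_big/=; apply: eq_bigr => a2 _.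
  under eq_bigr => b1 _ do under eq_bigr => b2 _ do rewrite sum_pair.
  under eq_bigr => b1 _ do rewrite exchange_big.
  rewrite exchange_big/=; apply: eq_bigr => a3 _.
  rewrite -mulrA /gram mulr_suml; apply: eq_bigr => b1 _.
  rewrite mulr_suml mulr_sumr; apply: eq_bigr => b2 _.
  rewrite !mulr_sumr; apply: eq_bigr => b3 _.
  by rewrite /F /pair_law /= !sqrtrM ?mulr_ge0//; ring.
rewrite !big_bool/= (gramC false true) !gram_diag /kappa -/(gram true false).
have -> : mass g false = 1 - mass g true by move: mass_total => <-; ring.
by ring.
Qed.

(** The gain probability of a transposition, compared on [N] columns: it is the
    same for all pairs of vertices. *)
Definition swap_prob (N : nat) : R :=
  Ex pair_law (fun y : {ffun 'I_N -> V * V} =>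
    (\prod_k pair_law (y k) <= \prod_k pair_law (swap_pair (y k)))%R%:R).

Lemma swap_prob_ge0 N : 0 <= swap_prob N.
Proof. by apply: Ex_ge0 => // t; exact: pair_law_ge0. Qed.

Lemma swap_prob_lb N (b : R) : 0 < b ->
  16 * N%:R * kappa g <= b ^+ 2 * (1 - 2 * kappa g) ->
  (1 - 2 * kappa g) ^+ N * expR (- b) / 2 <= swap_prob N.
Proof.
move=> b0 hb; rewrite -pair_affinity -{1}(card_ord N).
apply: affinity_prob_lb => //.
- exact: pair_law_ge0.
- exact: pair_law_total.
- by move=> [[a b'] [c d]].
- rewrite pair_affinity card_ord; apply: le_trans hb.
  by rewrite le_eqVlt; apply/orP; left; apply/eqP; ring.
Qed.

(** On the event, the likelihood is at most the geometric mean of the two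
    likelihoods after a swap, which sums to a product of triple affinities. *)
Lemma double_swap_prob_ub N :
  Ex triple_law (fun y : {ffun 'I_N -> V * V * V} =>
    (\prod_k (g (y k).1.1 * g (y k).1.2) <=
       \prod_k pair_law (swap_bit (y k).1.1 (y k).1.2))%R%:R *
    (\prod_k (g (y k).1.1 * g (y k).2) <=
       \prod_k pair_law (swap_bit (y k).1.1 (y k).2))%R%:R) <=
  (1 - 3 * kappa g) ^+ N.
Proof.
rewrite -triple_affinity -[in X in _ <= X](card_ord N) -prodr_const.
rewrite bigA_distr_bigA; apply: ler_sum => y _.
have L0 : 0 <= \prod_e triple_law (y e) by apply: prodr_ge0 => e _; exact: triple_law_ge0.
have pr (F G H : 'I_N -> R) : (forall k, 0 <= F k) -> (forall k, 0 <= G k) ->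
    (forall k, 0 <= H k) -> \prod_k F k <= \prod_k G k ->
    \prod_k (F k * H k) <= \prod_k (G k * H k).
  by move=> F0 G0 H0 FG; rewrite !big_split/= ler_wpM2r// prodr_ge0.
have [h12|_] := leP (\prod_k (g (y k).1.1 * g (y k).1.2)) _;
  last by rewrite mul0r mulr0 prodr_ge0// => k _; exact: sqrtr_ge0.
have [h13|_] := leP (\prod_k (g (y k).1.1 * g (y k).2)) _;
  last by rewrite mulr0 mulr0 prodr_ge0// => k _; exact: sqrtr_ge0.
rewrite !mulr1 sqrt_prod => [|k]; last by rewrite !mulr_ge0.
rewrite -(ger0_norm L0) -sqrtr_sqr ler_wsqrtr// expr2 [leRHS]big_split/=.
apply: ler_pM => //.
  apply: (pr _ _ (fun k => g (y k).2)) h12 => k //; exact: mulr_ge0.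
have -> : \prod_e triple_law (y e) =
    \prod_k (g (y k).1.1 * g (y k).2 * g (y k).1.2).
  by apply: eq_bigr => k _; rewrite /triple_law mulrAC.
apply: (pr _ _ (fun k => g (y k).1.2)) h13 => k //; exact: mulr_ge0.
Qed.

End LetterAffinity.

(** * Transpositions acting on labelled complete graphs *)

Section Spokes.
Variables (n : nat) (e0 : edge n).

(** The edge [{i, l}]; the default [e0] is only reached when [i = l]. *)
Definition link (i l : 'I_n) : edge n := insubd e0 [set i; l]%SET.

Lemma val_link i l : i != l -> val (link i l) = [set i; l]%SET.
Proof. by move=> il; rewrite /link val_insubd cards2 il. Qed.

Lemma link_inj i l i' l' : i != l -> i' != l' -> i != l' ->
  link i l = link i' l' -> i = i' /\ l = l'.
Proof.
move=> il il' h /(congr1 val); rewrite !val_link// => eq.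
have : i \in [set i'; l']%SET by rewrite -eq !inE eqxx.
rewrite !inE (negbTE h) orbF => /eqP ii'; split => //.
have : l \in [set i'; l']%SET by rewrite -eq !inE eqxx orbT.
by rewrite !inE -ii' eq_sym (negbTE il) => /eqP.
Qed.

Definition spokes (A : {set 'I_n}) (C : finType) (r : C -> 'I_n)
    (kc : 'I_#|A| * C) : edge n := link (r kc.2) (enum_val kc.1).

Lemma spokes_neq (A : {set 'I_n}) i (k : 'I_#|A|) : i \notin A -> i != enum_val k.
Proof. by apply: contraNneq => ->; exact: enum_valP. Qed.

Lemma spokes_inj (A : {set 'I_n}) (C : finType) (r : C -> 'I_n) :
  injective r -> (forall c, r c \notin A) -> injective (@spokes A _ r).
Proof.
move=> inj_r rA [k c] [k' c'] /link_inj []; rewrite ?spokes_neq//=.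
by move=> /inj_r -> /enum_val_inj ->.
Qed.

Lemma edge_mem (e : edge n) i : i \in val e -> exists2 l, i != l & e = link i l.
Proof.
move=> ie; have : #|val e| == 2 := valP e.
case/cards2P=> x [y [xy exy]].
move: ie; rewrite /= exy !inE => /orP[] /eqP ->.
  by exists y => //; apply: val_inj; rewrite val_link//; exact: exy.
have yx : y != x by rewrite eq_sym.
by exists x => //; apply: val_inj; rewrite val_link// finset.setUC; exact: exy.
Qed.

Lemma prod_star (R : realType) i j (H : edge n -> R) : i != j ->
  \prod_(e : edge n | (i \in val e) && (j \notin val e)) H e =
  \prod_(l in (~: [set i; j])%SET) H (link i l).
Proof.
move=> ij; rewrite -(big_imset (h := link i)) => [|l l' lA l'A /link_inj []] /=.
- apply: eq_bigl => e; apply/andP/imsetP => [[/edge_mem[l il ->]]|[l]].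
    rewrite val_link// !inE negb_or => /andP[_ jl].
    by exists l => //; rewrite !inE negb_or eq_sym il eq_sym jl.
  rewrite !inE negb_or => /andP[li lj] ->.
  have il : i != l by rewrite eq_sym.
  by rewrite val_link// !inE eqxx (eq_sym j i) (negbTE ij) (eq_sym j l) (negbTE lj).
- by move: lA; rewrite !inE negb_or eq_sym => /andP[].
- by move: l'A; rewrite !inE negb_or eq_sym => /andP[].
- by move: l'A; rewrite !inE negb_or eq_sym => /andP[].
- by [].
Qed.

Lemma edge_act_link i j l : i != j -> l != i -> l != j ->
  edge_act (tperm i j) (link i l) = link j l.
Proof.
move=> ij li lj; apply: val_inj; rewrite /= !val_link 1?eq_sym//.
by rewrite imsetU1 imset_set1 tpermL tpermD// eq_sym.
Qed.

Lemma edge_act_fix i j (e : edge n) : (i \in val e) = (j \in val e) ->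
  edge_act (tperm i j) e = e.
Proof.
move=> h; apply: val_inj; apply/setP => x /=.
rewrite -{1}[x](tpermK i j) (mem_imset _ _ (@perm_inj _ _)).
by case: tpermP => // ->; rewrite h.
Qed.

(** Apart from the edge joining them and the edges meeting neither, the
    transposition of [i] and [j] exchanges [{i, l}] with [{j, l}]. *)
Lemma prod_transposition (R : realType) i j (H : edge n -> R) : i != j ->
  \prod_(e : edge n) H e =
  \prod_(e : edge n | (i \in val e) == (j \in val e)) H e *
  \prod_(l in (~: [set i; j])%SET) (H (link i l) * H (link j l)).
Proof.
move=> ij; rewrite (bigID (fun e : edge n => (i \in val e) == (j \in val e)))/=.
congr (_ * _); rewrite big_split/= -prod_star// finset.setUC -prod_star 1?eq_sym//.
rewrite (bigID (fun e : edge n => i \in val e))/=; congr (_ * _).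
  by apply: eq_bigl => e; case: (i \in val e); case: (j \in val e).
by apply: eq_bigl => e; case: (i \in val e); case: (j \in val e).
Qed.

End Spokes.

(** The action on labels of composing the alignment of the singled out graph
    with [tau]. *)
Definition relabel (n : nat) (B : finType) (tau : 'S_n)
    (Y : {ffun edge n -> bool * B}) : {ffun edge n -> bool * B} :=
  [ffun e => ((Y (edge_act tau e)).1, (Y e).2)].

Section RowGain.
Variables (R : realType) (B : finType) (g : bool * B -> R).
Hypotheses (g0 : forall v, 0 <= g v) (g1 : \sum_v g v = 1).
Variables (n : nat) (e0 : edge n).

Let V := (bool * B)%type.
Implicit Types (A : {set 'I_n}) (Y : {ffun edge n -> bool * B}).

Definition row_gain A i j Y : bool :=
  \prod_(l in A) (g (Y (link e0 i l)) * g (Y (link e0 j l))) <=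
  \prod_(l in A) pair_law g (swap_bit (Y (link e0 i l)) (Y (link e0 j l))).

Lemma row_gainC A i j Y : row_gain A i j Y = row_gain A j i Y.
Proof.
rewrite /row_gain; congr (_ <= _); apply: eq_bigr => l _; first exact: mulrC.
by rewrite /pair_law mulrC.
Qed.

Lemma row_gain_relabel A i j Y : i != j -> (A \subset ~: [set i; j])%SET ->
  row_gain A i j Y -> row_gain (~: [set i; j] :\: A)%SET i j Y ->
  \prod_e g (Y e) <= \prod_e g (relabel (tperm i j) Y e).
Proof.
move=> ij AS; rewrite /row_gain => gA gA'.
rewrite !(prod_transposition e0 _ ij); apply: ler_pM.
- by apply: prodr_ge0.
- by apply: prodr_ge0 => l _; rewrite mulr_ge0.
- rewrite le_eqVlt; apply/orP; left; apply/eqP; apply: eq_bigr => e /eqP he.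
  by rewrite ffunE edge_act_fix// -surjective_pairing.
have -> : \prod_(l in (~: [set i; j])%SET)
      (g (relabel (tperm i j) Y (link e0 i l)) * g (relabel (tperm i j) Y (link e0 j l))) =
    \prod_(l in (~: [set i; j])%SET)
      pair_law g (swap_bit (Y (link e0 i l)) (Y (link e0 j l))).
  apply: eq_bigr => l; rewrite !inE negb_or => /andP[li lj].
  by rewrite !ffunE edge_act_link// tpermC edge_act_link// eq_sym.
rewrite (big_setID A)/= [leRHS](big_setID A)/= (finset.setIidPr AS).
by apply: ler_pM => //; apply: prodr_ge0 => l _; rewrite mulr_ge0.
Qed.

Let two (i j : 'I_n) (c : bool) := if c then i else j.

Let two_inj i j : i != j -> injective (two i j).
Proof. by move=> /eqP ij [] [] //= h; case: ij. Qed.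

Let gain N (y : {ffun 'I_N * bool -> bool * B}) : bool :=
  \prod_k (g (y (k, true)) * g (y (k, false))) <=
  \prod_k pair_law g (swap_bit (y (k, true)) (y (k, false))).

Let prod_enum A (F : 'I_n -> R) :
  \prod_(l in A) F l = \prod_(k < #|A|) F (enum_val k).
Proof. exact: big_enum_val. Qed.

Let row_gainE A i j Y :
  row_gain A i j Y = gain [ffun kc => Y (spokes e0 (A := A) (two i j) kc)].
Proof.
rewrite /row_gain /gain !(prod_enum A); congr (_ <= _).
  by apply: eq_bigr => k _; rewrite !ffunE.
by apply: eq_bigr => k _; rewrite !ffunE.
Qed.

Let gain_prob N : Ex g (fun y : {ffun 'I_N * bool -> bool * B} => (gain y)%:R) =
  swap_prob g N.
Proof.
pose enc (t : V * V) : {ffun bool -> V} := [ffun c : bool => if c then t.1 else t.2].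
have bij_enc : bijective enc.
  exists (fun h : {ffun bool -> V} => (h true, h false)) => [[v w]|h]; first by rewrite !ffunE.
  by apply/ffunP => -[]; rewrite ffunE.
rewrite (Ex_block g _ bij_enc) /swap_prob /Ex; apply: eq_bigr => y _.
congr (_ * _).
  by apply: eq_bigr => k _; rewrite big_bool !ffunE.
rewrite /gain; congr ((_ <= _)%R%:R).
  by apply: eq_bigr => k _; rewrite !ffunE.
by apply: eq_bigr => k _; rewrite !ffunE.
Qed.

Lemma row_gain_prob A i j : i != j -> i \notin A -> j \notin A ->
  Ex g (fun Y => (row_gain A i j Y)%:R) = swap_prob g #|A|.
Proof.
move=> ij iA jA; rewrite -gain_prob.
rewrite -(Ex_marginal (fun y => (gain y)%:R) g1 (@spokes_inj _ e0 A _ _ (two_inj ij) _)).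
  by apply: eq_Ex => Y; rewrite row_gainE.
by case.
Qed.

Lemma row_gain_indep A i j A' i' j' : i != j -> i' != j' ->
  i \notin A -> j \notin A -> i' \notin A' -> j' \notin A' ->
  (forall c c' (k : 'I_#|A|) (k' : 'I_#|A'|),
     link e0 (two i j c) (enum_val k) != link e0 (two i' j' c') (enum_val k')) ->
  Ex g (fun Y => (row_gain A i j Y)%:R * (row_gain A' i' j' Y)%:R) =
  swap_prob g #|A| * swap_prob g #|A'|.
Proof.
move=> ij ij' iA jA iA' jA' dis; rewrite -!gain_prob.
rewrite -(Ex_indep (fun y => (gain y)%:R) (fun y => (gain y)%:R) g1
  (@spokes_inj _ e0 A _ _ (two_inj ij) _) (@spokes_inj _ e0 A' _ _ (two_inj ij') _)).
- by apply: eq_Ex => Y; rewrite !row_gainE.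
- by case.
- by case.
- by move=> [k c] [k' c']; exact: dis.
Qed.

Lemma row_gain_disjoint A i j i' j' :
  i != j -> i' != j' -> i != i' -> i != j' -> j != i' -> j != j' ->
  i \notin A -> j \notin A -> i' \notin A -> j' \notin A ->
  Ex g (fun Y => (row_gain A i j Y)%:R * (row_gain A i' j' Y)%:R) =
  swap_prob g #|A| ^+ 2.
Proof.
move=> ij ij' h1 h2 h3 h4 iA jA iA' jA'; rewrite row_gain_indep// => c c' k k'.
apply/eqP => /link_inj[]; rewrite ?spokes_neq//; try by case: c; case: c'.
by case: c; case: c' => /= h _; move: h1 h2 h3 h4; rewrite h eqxx.
Qed.

Lemma row_gain_inout A A' i j : i != j -> [disjoint A & A'] ->
  i \notin A -> j \notin A -> i \notin A' -> j \notin A' ->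
  Ex g (fun Y => (row_gain A i j Y)%:R * (row_gain A' i j Y)%:R) =
  swap_prob g #|A| * swap_prob g #|A'|.
Proof.
move=> ij AA' iA jA iA' jA'; rewrite row_gain_indep// => c c' k k'.
apply/eqP => /link_inj[]; rewrite ?spokes_neq//; try by case: c; case: c'.
move=> _ h; move/disjointFr: AA' => /(_ _ (enum_valP k)).
by rewrite h enum_valP.
Qed.

Lemma row_gain_shared A i j k : i != j -> i != k -> j != k ->
  i \notin A -> j \notin A -> k \notin A ->
  Ex g (fun Y => (row_gain A i j Y)%:R * (row_gain A i k Y)%:R) <=
  (1 - 3 * kappa g) ^+ #|A|.
Proof.
move=> ij ik jk iA jA kA.
pose r (c : option bool) := if c is Some b then if b then j else k else i.
have inj_r : injective r.
  by move=> [[]|] [[]|] //= h; move: ij ik jk; rewrite h eqxx.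
pose enc (t : V * V * V) : {ffun option bool -> V} :=
  [ffun c => if c is Some b then if b then t.1.2 else t.2 else t.1.1].
have bij_enc : bijective enc.
  exists (fun h : {ffun option bool -> V} => (h None, h (Some true), h (Some false))) =>
    [[[u v] w]|h]; first by rewrite !ffunE.
  by apply/ffunP => -[[]|]; rewrite ffunE.
pose F (y : {ffun 'I_#|A| * option bool -> V}) : R :=
  (\prod_l (g (y (l, None)) * g (y (l, Some true))) <=
   \prod_l pair_law g (swap_bit (y (l, None)) (y (l, Some true))))%R%:R *
  (\prod_l (g (y (l, None)) * g (y (l, Some false))) <=
   \prod_l pair_law g (swap_bit (y (l, None)) (y (l, Some false))))%R%:R.
have -> : Ex g (fun Y => (row_gain A i j Y)%:R * (row_gain A i k Y)%:R) =
    Ex g (fun Y => F [ffun lc => Y (spokes e0 (A := A) r lc)]).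
  apply: eq_Ex => Y; rewrite /row_gain /F !(prod_enum A).
  by congr (_ * _); congr ((_ <= _)%R%:R); apply: eq_bigr => l _; rewrite !ffunE.
rewrite (Ex_marginal F g1 (@spokes_inj _ e0 A _ _ inj_r _)); last by case=> [[]|].
rewrite (Ex_block g _ bij_enc); apply: le_trans (double_swap_prob_ub g0 g1 #|A|).
rewrite le_eqVlt; apply/orP; left; apply/eqP; rewrite /Ex; apply: eq_bigr => y _.
congr (_ * _).
  apply: eq_bigr => l _; rewrite (bigD1 None)//= (bigD1 (Some true))//=.
  rewrite (bigD1 (Some false))//= big_pred0 => [|[[]|]]//.
  by rewrite !ffunE /triple_law mulr1 mulrA.
by rewrite /F; congr (_ * _); congr ((_ <= _)%R%:R); apply: eq_bigr => l _; rewrite !ffunE.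
Qed.

End RowGain.

(** * Existence of a likely transposition: second moment *)

Section SecondMoment.
Variables (R : realType) (B : finType) (g : bool * B -> R).
Hypotheses (g0 : forall v, 0 <= g v) (g1 : \sum_v g v = 1).
Variables (n : nat) (e0 : edge n).

Definition transposable (Y : {ffun edge n -> bool * B}) : bool :=
  [exists i : 'I_n, exists j : 'I_n, (i != j) &&
     (\prod_e g (Y e) <= \prod_e g (relabel (tperm i j) Y e))].

Lemma sum_indicator (S : {set 'I_n}) (i : 'I_n) (a b : R) : i \in S ->
  \sum_(k in S) (a + (i == k)%:R * b) = #|S|%:R * a + b.
Proof.
move=> iS; rewrite big_split/= sumr_const mulr_natl; congr (_ + _).
rewrite (bigD1 i)//= eqxx mul1r big1 ?addr0// => k /andP[_ ki].
by rewrite eq_sym (negbTE ki) mul0r.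
Qed.

Lemma triple_affinity_ge0 : 0 <= 1 - 3 * kappa g.
Proof. by rewrite -(triple_affinity g0 g1); apply: sumr_ge0 => t _; exact: sqrtr_ge0. Qed.

(** Cauchy--Schwarz for the number of pairs in [S1 * S2] whose exchange gains
    both on the edges towards the outside and on the edges inside [S1] and
    [S2]. The outside rows of distinct vertices are independent, so pairs
    without a common vertex are exactly uncorrelated there; the inside rows are
    not, and their indicator is just dropped from the second moment. *)
Lemma transposable_second_moment (S1 S2 : {set 'I_n}) (q N : nat) :
  [disjoint S1 & S2] -> #|S1| = q -> #|S2| = q ->
  #|(~: (S1 :|: S2))%SET| = N ->
  (q%:R ^+ 2 * (swap_prob g N * swap_prob g (q + q - 2)%N)) ^+ 2 <=
  Ex g (fun Y => (transposable Y)%:R) *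
    (q%:R ^+ 4 * swap_prob g N ^+ 2 + 2 * q%:R ^+ 3 * (1 - 3 * kappa g) ^+ N +
     q%:R ^+ 2 * swap_prob g N).
Proof.
move=> S12 c1 c2; set O := (~: (S1 :|: S2))%SET => <- {N}.
set N := #|O|; set P := swap_prob g N.
set T := (1 - 3 * kappa g) ^+ N.
have T0 : 0 <= T by rewrite exprn_ge0// triple_affinity_ge0.
have P0 : 0 <= P by exact: swap_prob_ge0.
have neq i j : i \in S1 -> j \in S2 -> i != j.
  by move=> iS jS; apply: contraTneq jS => <-; rewrite (disjointFr S12 iS).
have out1 i : i \in S1 -> i \notin O by move=> iS; rewrite !inE iS.
have out2 i : i \in S2 -> i \notin O by move=> iS; rewrite !inE iS orbT.
pose In i j := (~: [set i; j] :\: O)%SET.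
have cardIn i j : i \in S1 -> j \in S2 -> #|In i j| = (q + q - 2)%N.
  move=> iS jS.
  have -> : In i j = ((S1 :|: S2) :\: [set i; j])%SET.
    by apply/setP => x; rewrite !inE negbK andbC.
  rewrite cardsD cardsU c1 c2 (disjoint_setI0 S12) cards0 subn0.
  have /finset.setIidPr -> : ([set i; j] \subset S1 :|: S2)%SET.
    by apply/fintype.subsetP => x; rewrite !inE => /orP[] /eqP ->; rewrite ?iS ?jS ?orbT.
  by rewrite cards2 neq.
pose f i j (Y : {ffun edge n -> bool * B}) : R :=
  (row_gain g e0 O i j Y)%:R * (row_gain g e0 (In i j) i j Y)%:R.
pose cnt Y : R := \sum_(i in S1) \sum_(j in S2) f i j Y.
have Ecnt : Ex g cnt = q%:R ^+ 2 * (P * swap_prob g (q + q - 2)%N).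
  rewrite /cnt Ex_sum (eq_bigr (fun=> q%:R * (P * swap_prob g (q + q - 2)%N))).
    by rewrite sumr_const c1 -[LHS]mulr_natl expr2 mulrA.
  move=> i iS; rewrite Ex_sum (eq_bigr (fun=> P * swap_prob g (q + q - 2)%N)).
    by rewrite sumr_const c2 -[LHS]mulr_natl.
  move=> j jS; rewrite /f row_gain_inout ?cardIn ?neq ?(out1 _ iS) ?(out2 _ jS)//.
  - rewrite -setI_eq0; apply/eqP/setP => x; rewrite !inE.
    by case: (x \in S1); case: (x \in S2); rewrite ?andbF.
  - by rewrite !inE eqxx /= andbF.
  - by rewrite !inE eqxx orbT /= andbF.
have sub i j Y : i \in S1 -> j \in S2 -> f i j Y != 0 -> transposable Y.
  move=> iS jS; rewrite /f -natrM pnatr_eq0 mulnb eqb0 negbK => /andP[gO gI].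
  apply/existsP; exists i; apply/existsP; exists j; rewrite neq//=.
  apply: (row_gain_relabel g0 _ _ gO gI); rewrite ?neq//.
  apply/fintype.subsetP => x; rewrite !inE !negb_or => /andP[x1 x2].
  by apply/andP; split; [apply: contraNneq x1 => ->|apply: contraNneq x2 => ->].
have cntE Y : cnt Y = (transposable Y)%:R * cnt Y.
  have [_|nt] := boolP (transposable Y); first by rewrite mul1r.
  rewrite mul0r /cnt big1// => i iS; rewrite big1// => j jS.
  by apply/eqP; apply: contraNT nt; exact: sub.
have Ecnt2 : Ex g (fun Y => cnt Y ^+ 2) <=
    q%:R ^+ 4 * P ^+ 2 + 2 * q%:R ^+ 3 * T + q%:R ^+ 2 * P.
  pose h i j (Y : {ffun edge n -> bool * B}) : R := (row_gain g e0 O i j Y)%:R.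
  have pairE i j k l : i \in S1 -> j \in S2 -> k \in S1 -> l \in S2 ->
      Ex g (fun Y => h i j Y * h k l Y) <=
      (P ^+ 2 + (i == k)%:R * T) + (j == l)%:R * (T + (i == k)%:R * P).
    move=> iS jS kS lS.
    have [iO jO] := (out1 _ iS, out2 _ jS); have [kO lO] := (out1 _ kS, out2 _ lS).
    have [ij il kj kl] := And4 (neq _ _ iS jS) (neq _ _ iS lS) (neq _ _ kS jS) (neq _ _ kS lS).
    have [ji jk] : j != i /\ j != k by rewrite ![j == _]eq_sym.
    have [eik|ik] := eqVneq i k; have [ejl|jl] := eqVneq j l;
      rewrite ?mul1r ?mul0r ?addr0 -?eik -?ejl.
    - have -> : Ex g (fun Y => h i j Y * h i j Y) = P.
        rewrite /P -(row_gain_prob g1 e0 ij iO jO).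
        by apply: eq_Ex => Y; rewrite /h -natrM mulnb andbb.
      by rewrite addrA lerDr !addr_ge0// sqr_ge0.
    - by apply: (le_trans (row_gain_shared g0 g1 e0 ij il jl iO jO lO)); rewrite lerDr sqr_ge0.
    - have -> : Ex g (fun Y => h i j Y * h k j Y) = Ex g (fun Y => h j i Y * h j k Y).
        by apply: eq_Ex => Y; rewrite /h row_gainC [in X in _ * X]row_gainC.
      by apply: (le_trans (row_gain_shared g0 g1 e0 ji jk ik jO iO kO)); rewrite lerDr sqr_ge0.
    - by rewrite row_gain_disjoint.
  have cnt_le Y : cnt Y ^+ 2 <= \sum_(i in S1) \sum_(j in S2)
      \sum_(k in S1) \sum_(l in S2) h i j Y * h k l Y.
    have -> : \sum_(i in S1) \sum_(j in S2)
        \sum_(k in S1) \sum_(l in S2) h i j Y * h k l Y =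
        (\sum_(i in S1) \sum_(j in S2) h i j Y) ^+ 2.
      rewrite expr2 mulr_suml; apply: eq_bigr => i _.
      rewrite mulr_suml; apply: eq_bigr => j _.
      rewrite mulr_sumr; apply: eq_bigr => k _.
      by rewrite mulr_sumr.
    apply: lerXn2r; rewrite ?nnegrE.
    - by apply: sumr_ge0 => i _; apply: sumr_ge0 => j _; rewrite mulr_ge0.
    - by apply: sumr_ge0 => i _; apply: sumr_ge0 => j _.
    apply: ler_sum => i _; apply: ler_sum => j _.
    by rewrite /f ler_piMr// lern1 leq_b1.
  apply: (le_trans (ler_Ex g0 cnt_le)).
  rewrite Ex_sum; apply: (@le_trans _ _ (\sum_(i in S1) \sum_(j in S2)
     (q%:R ^+ 2 * P ^+ 2 + q%:R * T + (q%:R * T + P)))).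
    apply: ler_sum => i iS; rewrite Ex_sum; apply: ler_sum => j jS.
    rewrite Ex_sum; apply: (@le_trans _ _ (\sum_(k in S1)
      ((q%:R * P ^+ 2 + T) + (i == k)%:R * (q%:R * T + P)))).
      apply: ler_sum => k kS; rewrite Ex_sum.
      apply: (@le_trans _ _ (\sum_(l in S2)
        ((P ^+ 2 + (i == k)%:R * T) + (j == l)%:R * (T + (i == k)%:R * P)))).
        by apply: ler_sum => l lS; exact: pairE.
      rewrite sum_indicator// c2 le_eqVlt; apply/orP; left; apply/eqP; ring.
    by rewrite sum_indicator// c1 le_eqVlt; apply/orP; left; apply/eqP; ring.
  rewrite (eq_bigr (fun=> q%:R * (q%:R ^+ 2 * P ^+ 2 + q%:R * T + (q%:R * T + P)))).
    rewrite sumr_const c1 -[X in X <= _]mulr_natl le_eqVlt; apply/orP; left; apply/eqP.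
    by ring.
  by move=> i _; rewrite sumr_const c2 -[LHS]mulr_natl.
rewrite -Ecnt.
have -> : Ex g cnt = Ex g (fun Y => (transposable Y)%:R * cnt Y).
  by apply: eq_Ex => Y; exact: cntE.
apply: (le_trans (Ex_cauchy _ _ g0)).
have -> : Ex g (fun Y => (transposable Y)%:R ^+ 2) = Ex g (fun Y => (transposable Y)%:R).
  by apply: eq_Ex => Y; rewrite -natrX; case: (transposable Y).
by apply: ler_wpM2l => //; apply: Ex_ge0.
Qed.

End SecondMoment.

(** * From the alignment model to edge labels *)

Lemma Ex_push (R : realType) (I V W : finType) (c : W -> R) (phi : W -> V)
    (F : {ffun I -> V} -> R) :
  Ex c (fun Z => F [ffun e => phi (Z e)]) =
  Ex (fun v => \sum_(z | phi z == v) c z) F.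
Proof.
rewrite /Ex (partition_big (fun Z : {ffun I -> W} => [ffun e => phi (Z e)]) xpredT)//=.
apply: eq_bigr => Y _; rewrite bigA_distr_big_dep mulr_suml.
apply: eq_big => [Z|Z /eqP -> //].
apply/eqP/familyP => [<- e|h]; first by rewrite ffunE; exact/eqP.
by apply/ffunP => e; rewrite ffunE; apply/eqP; exact: h.
Qed.

Section Labels.
Variables (m' n : nat).
Let m := m'.+2.
Let B := {ffun 'I_m'.+1 -> bool}.
Let V := (bool * B)%type.
Implicit Types (Y : {ffun edge n -> V}) (al : alignment m n).

(** The label of an edge is the vector of its [m] observed bits, the last graph
    being kept apart from the other ones. *)
Definition encode (z : bool * {ffun 'I_m -> bool}) : V :=
  (z.1 && z.2 ord_max, [ffun j => z.1 && z.2 (lift ord_max j)]).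

Definition decode (v : V) (k : 'I_m) : bool :=
  if unlift ord_max k is Some j then v.2 j else v.1.

Lemma encodeK z k : decode (encode z) k = z.1 && z.2 k.
Proof. by rewrite /decode; case: unliftP => [j|] ->; rewrite ?ffunE. Qed.

Lemma decode_inj v v' : decode v =1 decode v' -> v = v'.
Proof.
case: v v' => [a b] [a' b'] h; congr (_, _).
  by have := h ord_max; rewrite /decode unlift_none.
by apply/ffunP => j; have := h (lift ord_max j); rewrite /decode liftK.
Qed.

Definition letter_law (R : realType) (p s : R) (v : V) : R :=
  p * (bernoulli_pmf s v.1 * \prod_j bernoulli_pmf s (v.2 j)) +
  (1 - p) * (v == (false, [ffun=> false]))%:R.

Lemma letter_lawE (R : realType) (p s : R) v :
  letter_law p s v =
  \sum_(z | encode z == v) bernoulli_pmf p z.1 * \prod_k bernoulli_pmf s (z.2 k).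
Proof.
rewrite big_mkcond sum_pair big_bool/= /letter_law; congr (_ + _).
  rewrite (bigD1 [ffun k => decode v k])//= ifT; last first.
    apply/eqP/decode_inj => k; by rewrite encodeK ffunE.
  rewrite [X in _ = _ + X]big1 ?addr0 => [|t /negbTE tv].
    congr (_ * _); rewrite [in RHS](bigD1_ord (ord_max : 'I_m))//= ffunE {1}/decode unlift_none.
    by congr (_ * _); apply: eq_bigr => j _; rewrite ffunE /decode liftK.
  rewrite ifF//; apply/negbTE; move/negbT: tv; apply: contra => /eqP <-.
  by apply/eqP/ffunP => k; rewrite ffunE encodeK.
have enc0 t : encode (false, t) = (false, [ffun=> false]).
  apply: decode_inj => k; rewrite encodeK /decode.
  by case: (unlift ord_max k) => //= j; rewrite ffunE.
under eq_bigr => t _ do rewrite enc0 eq_sym.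
have [_|_] := eqVneq v (false, [ffun=> false]); last by rewrite mulr0 big1.
by rewrite -mulr_sumr sum_bern_prod.
Qed.

Lemma letter_law_ge0 (R : realType) (p s : R) v : 0 <= p <= 1 -> 0 <= s <= 1 ->
  0 <= letter_law p s v.
Proof.
move=> p01 s01; rewrite letter_lawE; apply: sumr_ge0 => z _.
by rewrite mulr_ge0 ?prodr_ge0 => // [|k _]; exact: bernoulli_pmf_ge0.
Qed.

Lemma letter_law_total (R : realType) (p s : R) : \sum_v letter_law p s v = 1.
Proof.
transitivity (\sum_(z : bool * {ffun 'I_m -> bool})
    bernoulli_pmf p z.1 * \prod_k bernoulli_pmf s (z.2 k)).
  rewrite [RHS](partition_big encode xpredT)//=.
  by apply: eq_bigr => v _; rewrite letter_lawE.
rewrite sum_pair big_bool -!mulr_sumr/=.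
by rewrite sum_bern_prod /bernoulli_pmf !mulr1 addrC subrK.
Qed.

Definition labels (w : sample m n) : {ffun edge n -> V} :=
  [ffun e => encode (parent w e, [ffun k => keep w k e])].

Definition label_obs al Y : observation m n :=
  [ffun k => \matrix_(i, j)
     [exists e : edge n, (val (edge_act (align_perm al k) e) == [set i; j]%SET) &&
        decode (Y e) k]].

Lemma label_obsE (w : sample m n) : obs w = label_obs (pistar w) (labels w).
Proof.
apply/ffunP => k; rewrite !ffunE; apply/matrixP => i j; rewrite !mxE.
by apply: eq_existsb => e; rewrite ffunE encodeK/= ffunE.
Qed.

Lemma prob_labels (R : realType) (p s : R)
    (A : alignment m n -> {ffun edge n -> V} -> bool) :
  prob p s (fun w : sample m n => A (pistar w) (labels w)) =
  #|{: alignment m n}|%:R^-1 *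
  \sum_(al : alignment m n) Ex (letter_law p s) (fun Y => (A al Y)%:R).
Proof.
rewrite /prob big_mkcond sum_pair sum_pair mulr_sumr; apply: eq_bigr => al _ /=.
have -> : Ex (letter_law p s) (fun Y => (A al Y)%:R) =
    Ex (fun v => \sum_(z | encode z == v)
      bernoulli_pmf p z.1 * \prod_k bernoulli_pmf s (z.2 k)) (fun Y => (A al Y)%:R).
  by apply: eq_bigr => Y _; congr (_ * _); apply: eq_bigr => e _; rewrite letter_lawE.
rewrite -Ex_push -(sum_pair (fun x : {ffun edge n -> bool} * {ffun 'I_m * edge n -> bool} =>
  if A al (labels (al, x.1, x.2)) then law p s ((al, x.1, x.2) : sample m n) else 0)).
pose Z2w (Z : {ffun edge n -> bool * {ffun 'I_m -> bool}}) :
    {ffun edge n -> bool} * {ffun 'I_m * edge n -> bool} :=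
  ([ffun e => (Z e).1], [ffun ke => (Z ke.2).2 ke.1]).
have bij : bijective Z2w.
  exists (fun x : {ffun edge n -> bool} * {ffun 'I_m * edge n -> bool} =>
            [ffun e => (x.1 e, [ffun k => x.2 (k, e)])]) => [Z|[X xi]].
    apply/ffunP => e; rewrite ffunE [RHS]surjective_pairing; congr (_, _).
      by rewrite ffunE.
    by apply/ffunP => k; rewrite !ffunE.
  congr (_, _); apply/ffunP; first by move=> e; rewrite !ffunE.
  by move=> [k e]; rewrite !ffunE.
rewrite (reindex Z2w) /Ex /=; last exact: onW_bij.
rewrite mulr_sumr; apply: eq_bigr => Z _.
have -> : labels (al, [ffun e => (Z e).1], [ffun ke => (Z ke.2).2 ke.1]) =
    [ffun e => encode (Z e)].
  apply/ffunP => e; rewrite !ffunE; apply: decode_inj => k; rewrite !encodeK/=.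
  by rewrite /parent /keep/= !ffunE.
have -> : law p s ((al, [ffun e => (Z e).1], [ffun ke => (Z ke.2).2 ke.1]) : sample m n) =
   #|{: alignment m n}|%:R^-1 *
     \prod_e (bernoulli_pmf p (Z e).1 * \prod_k bernoulli_pmf s ((Z e).2 k)).
  rewrite /law -mulrA big_split/=; congr (_ * (_ * _)).
    by apply: eq_bigr => e _; rewrite /parent/= ffunE.
  rewrite exchange_big pair_bigA/=; apply: eq_bigr => ke _.
  by rewrite /keep/= ffunE.
by case: (A al _); rewrite ?mulr1 ?mulr0.
Qed.

(** The alignment that explains the same observation once the labels of the last
    graph are permuted by [tau]. *)
Lemma twist_subproof (tau : 'S_n) al :
  [forall k : 'I_m, (val k == 0)%N ==>
     ([ffun k => if k == ord_max then (tau * align_perm al k)%g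
                 else align_perm al k] k == 1%g)].
Proof.
apply/forallP => k; apply/implyP => k0; rewrite ffunE ifF.
  by have /forallP/(_ k)/implyP/(_ k0) := valP al.
by apply/negbTE; apply: contraTneq k0 => ->.
Qed.

Definition twist (tau : 'S_n) al : alignment m n :=
  exist _ [ffun k => if k == ord_max then (tau * align_perm al k)%g
                     else align_perm al k] (twist_subproof tau al).

Lemma twist_neq i j al : i != j -> twist (tperm i j) al != al.
Proof.
move=> ij; apply/eqP => /(congr1 (fun al => align_perm al ord_max i)).
rewrite /align_perm /= ffunE eqxx permM tpermL => /perm_inj /eqP.
by rewrite eq_sym (negbTE ij).
Qed.

Lemma label_obs_twist tau al Y :
  label_obs (twist tau al) (relabel tau Y) = label_obs al Y.
Proof.
apply/ffunP => k; rewrite !ffunE; apply/matrixP => i j; rewrite !mxE.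
rewrite {1}/align_perm /= ffunE /decode; case: unliftP => [l kl|->].
  rewrite ifF; last by rewrite kl eq_sym; apply/negbTE/neq_lift.
  by apply: eq_existsb => e; rewrite ffunE.
have actM (rho : 'S_n) (e : {set 'I_n}) :
    ((tau * rho)%g @: e = rho @: (tau @: e))%SET.
  by rewrite -imset_comp; apply: eq_imset => x; rewrite /= permM.
rewrite eqxx; apply/existsP/existsP => -[e].
  by rewrite ffunE actM; exists (edge_act tau e).
have eK : edge_act tau (edge_act tau^-1 e) = e.
  apply: val_inj; rewrite /= -imset_comp -[RHS]imset_id; apply: eq_imset => x.
  by rewrite /= permKV.
have eKv : (tau @: (tau^-1%g @: val e))%SET = val e := congr1 val eK.
by exists (edge_act tau^-1 e); rewrite ffunE eK actM /= eKv.
Qed.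

Lemma label_obs_inj al : injective (label_obs al).
Proof.
move=> Y Y' h; apply/ffunP => e; apply: decode_inj => k.
have read (Z : {ffun edge n -> V}) i j :
    val (edge_act (align_perm al k) e) = [set i; j]%SET ->
    label_obs al Z k i j = decode (Z e) k.
  move=> eij; rewrite ffunE mxE -eij; apply/existsP/idP => [[f /andP[]]|Ze].
    by move=> /eqP /(imset_inj (@perm_inj _ _)) /val_inj ->.
  by exists e; rewrite eqxx.
have : #|val (edge_act (align_perm al k) e)| == 2 :=
  valP (edge_act (align_perm al k) e).
by case/cards2P => i [j [_ eij]]; rewrite -!(read _ _ _ eij) h.
Qed.

Lemma ov_eq1 (R : realType) al al' : ov R al al' == 1 -> al = al'.
Proof.
rewrite /ov; set S := [set i | _]%SET => /eqP ov1.
have n0 : (n%:R : R) != 0.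
  by apply/eqP => n0; move: ov1; rewrite n0 invr0 mulr0 => /esym/eqP; rewrite oner_eq0.
have Sn : #|S| = n.
  apply/eqP; rewrite -(eqr_nat R); apply/eqP.
  by move/(congr1 (fun x => x * n%:R)): ov1; rewrite divfK// mul1r.
have ST : S = [set: 'I_n]%SET by apply/eqP; rewrite eqEcard finset.subsetT cardsT card_ord Sn leqnn.
apply: val_inj; apply/ffunP => k; have [k0|k0] := eqVneq (val k) 0%N.
  have /forallP/(_ k)/implyP/(_ (introT eqP k0))/eqP -> := valP al.
  by have /forallP/(_ k)/implyP/(_ (introT eqP k0))/eqP -> := valP al'.
apply/permP => i; have : i \in S by rewrite ST inE.
by rewrite inE => /forallP/(_ k); rewrite lt0n k0 => /eqP.
Qed.

(** When some transposition does not decrease the likelihood of the labels, the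
    true alignment and its twist explain the same observation and the estimator
    misses one of them. Sending a correctly estimated pair (alignment, labels)
    to its twisted pair is injective, because the observation determines the
    estimate, hence the alignment, hence the labels. *)
Lemma transposable_le_failure (R : realType) (p s : R) (est : estimator m n) :
  0 <= p <= 1 -> 0 <= s <= 1 ->
  Ex (letter_law p s) (fun Y => (transposable (letter_law p s) Y)%:R) <=
  2 * (1 - prob p s (fun w : sample m n => ov R (pistar w) (est (obs w)) == 1)).
Proof.
move=> p01 s01; set g := letter_law p s.
have g0 v : 0 <= g v by exact: letter_law_ge0.
have g1 : \sum_v g v = 1 by exact: letter_law_total.
pose suc al Y := est (label_obs al Y) == al.
set a : R := #|{: alignment m n}|%:R^-1.
have prob_suc : prob p s (fun w : sample m n => ov R (pistar w) (est (obs w)) == 1) <=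
    a * \sum_(al : alignment m n) Ex g (fun Y => (suc al Y)%:R).
  rewrite -prob_labels /prob [leLHS]big_mkcond [leRHS]big_mkcond/=.
  have law0 (w : sample m n) : 0 <= law p s w.
    by rewrite /law !mulr_ge0 ?invr_ge0 ?prodr_ge0// => k _; exact: bernoulli_pmf_ge0.
  apply: ler_sum => w _; case: ifP => [/ov_eq1 h|_]; last by case: ifP.
  by rewrite ifT// /suc -label_obsE -h.
have al0 : (#|{: alignment m n}|%:R : R) != 0.
  have := prob_total m n p s; rewrite /prob /law.
  apply: contra_eq_neq => ->; rewrite invr0 eq_sym.
  by rewrite big1 ?oner_eq0// => w _; rewrite !mul0r.
have a0 : 0 <= a by rewrite invr_ge0.
pose G (x : alignment m n * {ffun edge n -> V}) : R := \prod_e g (x.2 e).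
have G0 x : 0 <= G x by rewrite prodr_ge0.
have joint (A : alignment m n -> {ffun edge n -> V} -> bool) :
    \sum_al Ex g (fun Y => (A al Y)%:R) = \sum_(x | A x.1 x.2) G x.
  rewrite [RHS]big_mkcond sum_pair; apply: eq_bigr => al _; apply: eq_bigr => Y _.
  by case: (A al Y); rewrite ?mulr1 ?mulr0.
have cst (A : {ffun edge n -> V} -> R) :
    a * (\sum_(al : alignment m n) Ex g A) = Ex g A.
  by rewrite sumr_const -[X in a * X]mulr_natl mulrA mulVf ?mul1r.
have fail : 1 - a * (\sum_al Ex g (fun Y => (suc al Y)%:R)) =
    a * (\sum_al Ex g (fun Y => (~~ suc al Y)%:R)).
  apply/eqP; rewrite subr_eq -mulrDr -big_split/=; apply/eqP.
  rewrite -[LHS](@Ex_cst _ (edge n) _ _ 1 g1) -[LHS]cst; congr (_ * _).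
  apply: eq_bigr => al _; rewrite /Ex -big_split; apply: eq_bigr => Y _ /=.
  by rewrite -mulrDr; case: (suc al Y); rewrite ?addr0 ?add0r.
apply: (@le_trans _ _ (2 * (a * (\sum_al Ex g (fun Y => (~~ suc al Y)%:R))))); last first.
  by rewrite -fail ler_pM2l// lerB.
have double (z : R) : 2 * z = z + z by ring.
rewrite -cst mulrCA ler_wpM2l// !joint double.
rewrite (bigID (fun x : alignment m n * {ffun edge n -> V} => suc x.1 x.2))/=.
apply: lerD; last first.
  rewrite [leLHS]big_mkcond [leRHS]big_mkcond; apply: ler_sum => x _.
  by case: (suc _ _); rewrite ?andbF//=; case: ifP.
pose good Y (ij : 'I_n * 'I_n) := (ij.1 != ij.2) &&
  (\prod_e g (Y e) <= \prod_e g (relabel (tperm ij.1 ij.2) Y e)).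
pose phi (x : alignment m n * {ffun edge n -> V}) :=
  if [pick ij | good x.2 ij] is Some ij
  then (twist (tperm ij.1 ij.2) x.1, relabel (tperm ij.1 ij.2) x.2) else x.
have phi_obs x : label_obs (phi x).1 (phi x).2 = label_obs x.1 x.2.
  by rewrite /phi; case: pickP => //= ij _; rewrite label_obs_twist.
have phi_good x : transposable g x.2 -> G x <= G (phi x) /\ (phi x).1 != x.1.
  move=> /existsP[i /existsP[j ij]]; rewrite /phi; case: pickP => [[i' j'] /andP[h1 h2]|].
    by split => //; exact: twist_neq.
  by move=> /(_ (i, j)); rewrite /good ij.
pose D := [set x : alignment m n * {ffun edge n -> V} |
             transposable g x.2 && suc x.1 x.2]%SET.
have phi_inj : {in D &, injective phi}.
  move=> [al Y] [al' Y']; rewrite !inE /= => /andP[_ /eqP sx] /andP[_ /eqP sy] h.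
  have := phi_obs (al, Y); rewrite h phi_obs /= => ho.
  have eal : al = al' by rewrite -sx -sy ho.
  by congr (_, _) => //; apply: (@label_obs_inj al); rewrite -ho eal.
apply: (@le_trans _ _ (\sum_(x in D) G (phi x))).
  rewrite (eq_bigl (fun x => x \in D)) => [|x]; last by rewrite inE.
  by apply: ler_sum => x; rewrite inE => /andP[tr _]; case: (phi_good x tr).
rewrite -(big_imset (h := phi) G phi_inj) [leLHS]big_mkcond [leRHS]big_mkcond.
apply: ler_sum => x _; case: ifP => [/imsetP[y yD ->]|_]; last by case: ifP.
rewrite ifT//; move: yD; rewrite inE => /andP[tr /eqP sy].
have [_ h] := phi_good y tr.
by rewrite /suc phi_obs sy eq_sym.
Qed.

End Labels.

(** * The exponent of the alignment model *)

Lemma one_minus_expr_le (R : realType) (s : R) k : 0 <= s <= 1 ->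
  1 - (1 - s) ^+ k <= k%:R * s.
Proof.
move=> /andP[s0 s1]; elim: k => [|k IH]; first by rewrite expr0 subrr mul0r.
have h0 : 0 <= (1 - s) ^+ k by rewrite exprn_ge0// subr_ge0.
have h1 : (1 - s) ^+ k <= 1 by rewrite exprn_ile1// ?subr_ge0// lerBlDr lerDl.
rewrite exprS -natr1; move: ((1 - s) ^+ k) h0 h1 IH => x x0 x1 IH; nra.
Qed.

Section Exponent.
Variables (R : realType) (m' : nat) (p s : R).
Hypotheses (p01 : 0 <= p <= 1) (s01 : 0 <= s <= 1).

Let r := (1 - s) ^+ m'.+1.
Let u := p * (1 - s) * r.
Let g := letter_law (m' := m') p s.

Let p0 : 0 <= p. Proof. by case/andP: p01. Qed.
Let p1 : p <= 1. Proof. by case/andP: p01. Qed.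
Let s0 : 0 <= s. Proof. by case/andP: s01. Qed.
Let s1 : 0 <= 1 - s. Proof. by rewrite subr_ge0; case/andP: s01. Qed.
Let r0 : 0 <= r. Proof. exact: exprn_ge0. Qed.
Let r1 : r <= 1. Proof. by rewrite exprn_ile1// lerBlDr lerDl. Qed.
Let u0 : 0 <= u. Proof. by rewrite !mulr_ge0. Qed.
Let P00_ge0 : 0 <= 1 - p + u. Proof. by rewrite addr_ge0// subr_ge0. Qed.
Let up : u <= p.
Proof.
rewrite /u -mulrA -[leRHS]mulr1 ler_wpM2l// mulr_ile1// lerBlDr lerDl//.
Qed.

(** Only whether some other graph contains the edge matters: the exponent is
    that of two graphs whose edges survive with probabilities [s] and
    [1 - (1 - s) ^+ m'.+1], both subsampled from the same parent. *)
Lemma kappa_letter_law :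
  kappa g = p * s * (1 - r) * (Num.sqrt (1 - p + u) - Num.sqrt u) ^+ 2.
Proof.
pose eta (b : {ffun 'I_m'.+1 -> bool}) := \prod_j bernoulli_pmf s (b j).
pose b0 : {ffun 'I_m'.+1 -> bool} := [ffun=> false].
have eta0 b : 0 <= eta b by apply: prodr_ge0 => j _; exact: bernoulli_pmf_ge0.
have eta_total : \sum_b eta b = 1 by exact: sum_bern_prod.
have eta_b0 : eta b0 = r.
  rewrite /eta (eq_bigr (fun=> 1 - s)) => [|j _]; last by rewrite ffunE.
  by rewrite prodr_const card_ord.
have eta_other : \sum_(b | b != b0) eta b = 1 - r.
  by move: eta_total; rewrite (bigD1 b0)//= eta_b0 => <-; ring.
have gt b : g (true, b) = p * s * eta b.
  by rewrite /g /letter_law/= ?xpair_eqE/= mulr0 addr0 mulrA.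
have gf b : g (false, b) = p * (1 - s) * eta b + (1 - p) * (b == b0)%:R.
  by rewrite /g /letter_law/= ?xpair_eqE/= mulrA.
have mt : mass g true = p * s.
  rewrite /mass; under eq_bigr => b _ do rewrite gt.
  by rewrite -mulr_sumr eta_total mulr1.
have mf : mass g false = 1 - p * s.
  by have := mass_total (@letter_law_total m' R p s); rewrite -/g mt => <-; ring.
have overlap : \sum_b Num.sqrt (g (true, b)) * Num.sqrt (g (false, b)) =
    p * Num.sqrt (s * (1 - s)) * (1 - r) +
    Num.sqrt (p * s * r) * Num.sqrt (1 - p + u).
  rewrite (bigD1 b0)//= addrC; congr (_ + _).
    rewrite -eta_other mulr_sumr; apply: eq_bigr => b /negbTE nb.
    rewrite gt gf nb mulr0 addr0 -sqrtrM ?mulr_ge0//.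
    have -> : p * s * eta b * (p * (1 - s) * eta b) =
      s * (1 - s) * (p * eta b) ^+ 2 by ring.
    by rewrite sqrtrM ?mulr_ge0// sqrtr_sqr ger0_norm ?mulr_ge0//; ring.
  by rewrite gt gf eqxx eta_b0 mulr1 addrC.
rewrite /kappa mt mf overlap.
have cross : Num.sqrt (s * (1 - s)) * Num.sqrt (p * s * r) = s * Num.sqrt u.
  rewrite -sqrtrM ?mulr_ge0//.
  have -> : s * (1 - s) * (p * s * r) = s ^+ 2 * u by rewrite /u; ring.
  by rewrite sqrtrM ?sqr_ge0// sqrtr_sqr ger0_norm.
have sqss : Num.sqrt (s * (1 - s)) ^+ 2 = s * (1 - s) by rewrite sqr_sqrtr ?mulr_ge0.
have sqr' : Num.sqrt (p * s * r) ^+ 2 = p * s * r by rewrite sqr_sqrtr ?mulr_ge0.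
have sqP : Num.sqrt (1 - p + u) ^+ 2 = 1 - p + u by rewrite sqr_sqrtr ?P00_ge0.
have squ : Num.sqrt u ^+ 2 = u by rewrite sqr_sqrtr.
move: cross sqss sqr' sqP squ.
move: (Num.sqrt (s * (1 - s))) (Num.sqrt (p * s * r)) (Num.sqrt (1 - p + u)) (Num.sqrt u).
move=> w v x y cross sqss sqr' sqP squ.
have -> : (p * w * (1 - r) + v * x) ^+ 2 =
    p ^+ 2 * (1 - r) ^+ 2 * w ^+ 2 + v ^+ 2 * x ^+ 2 + 2 * p * (1 - r) * x * (w * v).
  by ring.
have -> : (x - y) ^+ 2 = x ^+ 2 + y ^+ 2 - 2 * x * y by ring.
by rewrite cross sqss sqr' sqP squ /u; ring.
Qed.

Lemma kappa_ge0 : 0 <= kappa g.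
Proof. by rewrite kappa_letter_law mulr_ge0 ?sqr_ge0// !mulr_ge0// subr_ge0. Qed.

Let sqrt_diff_ge0 : 0 <= Num.sqrt (1 - p + u) - Num.sqrt u.
Proof. by rewrite subr_ge0 ler_wsqrtr// lerDr subr_ge0. Qed.

Lemma kappa_le : kappa g <= p * s.
Proof.
have P00 : Num.sqrt (1 - p + u) <= 1.
  by rewrite -[leRHS]sqrtr1 ler_wsqrtr// -addrA gerDl addrC subr_le0.
rewrite kappa_letter_law -mulrA -[leRHS]mulr1 ler_wpM2l ?mulr_ge0//.
rewrite mulr_ile1 ?subr_ge0 ?sqr_ge0 ?lerBlDr ?lerDl// exprn_ile1//.
by rewrite lerBlDr (le_trans P00)// lerDl sqrtr_ge0.
Qed.

(** Replacing [u] by [p] costs a factor which tends to 1 with [p * s]. *)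
Lemma kappa_threshold (z : R) : m'.+2%:R * (p * s) <= z -> z + Num.sqrt z <= 1 ->
  kappa g * (1 - (z + Num.sqrt z)) ^+ 2 <= p * s * (1 - r) * (1 - Num.sqrt p) ^+ 2.
Proof.
move=> hz t1; set t := z + Num.sqrt z in t1 *.
have dz : p - u <= z.
  apply: le_trans hz; have := one_minus_expr_le m'.+2 s01.
  rewrite exprS -/r => h; have -> : p - u = p * (1 - (1 - s) * r) by rewrite /u; ring.
  by rewrite mulrCA ler_wpM2l.
have z0 : 0 <= z by apply: le_trans dz; rewrite subr_ge0.
rewrite kappa_letter_law -mulrA -exprMn ler_wpM2l ?mulr_ge0 ?subr_ge0//.
apply: lerXn2r; rewrite ?nnegrE ?subr_ge0.
- by rewrite mulr_ge0// subr_ge0.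
- by rewrite -[leRHS]sqrtr1 ler_wsqrtr.
have sqP : Num.sqrt (1 - p + u) ^+ 2 = 1 - p + u by rewrite sqr_sqrtr ?P00_ge0.
have squ : Num.sqrt u ^+ 2 = u by rewrite sqr_sqrtr.
have sqp : Num.sqrt p ^+ 2 = p by rewrite sqr_sqrtr.
have sqz : Num.sqrt z ^+ 2 = z by rewrite sqr_sqrtr.
have x0 := sqrtr_ge0 (1 - p + u); have y0 := sqrtr_ge0 u.
have w0 := sqrtr_ge0 p; have v0 := sqrtr_ge0 z.
have xlb : 1 - z <= Num.sqrt (1 - p + u).
  have [z1|z1] := leP 1 z; first by apply: le_trans x0; rewrite subr_le0.
  rewrite -(@ler_pXn2r _ 2)// ?nnegrE ?subr_ge0 ?(ltW z1)// sqP.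
  have : 0 <= z * (1 - z) by rewrite mulr_ge0// subr_ge0 ltW.
  by move: dz; rewrite sqrrB expr1n; lra.
have ylb : Num.sqrt p <= Num.sqrt u + Num.sqrt z.
  rewrite -(@ler_pXn2r _ 2)// ?nnegrE ?addr_ge0// sqp sqrrD squ sqz.
  by have := mulr_ge0 y0 v0; lra.
have w1 : 0 < 1 + Num.sqrt p by rewrite ltr_pwDl.
rewrite -(ler_pM2r w1).
have -> : (1 - Num.sqrt p) * (1 + Num.sqrt p) =
    (Num.sqrt (1 - p + u) - Num.sqrt u) * (Num.sqrt (1 - p + u) + Num.sqrt u).
  by rewrite -!subr_sqr sqP squ sqp; ring.
rewrite -mulrA ler_wpM2l//.
have tw : 0 <= t * Num.sqrt p by rewrite mulr_ge0// addr_ge0.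
by move: xlb ylb tw; rewrite /t; lra.
Qed.

End Exponent.

(** * The second moment below the threshold *)

Lemma exists_subset_card (T : finType) (A : {set T}) k : (k <= #|A|)%N ->
  exists2 S : {set T}, (S \subset A)%SET & #|S| = k.
Proof.
move=> kA; have : (0 < #|[set S : {set T} | S \subset A & #|S| == k]%SET|)%N.
  by rewrite cards_draws bin_gt0.
by case/card_gt0P => S; rewrite inE => /andP[SA /eqP cS]; exists S.
Qed.

Lemma le_expR2_sqr (R : realType) (a : R) : 0 <= a -> a ^+ 2 <= expR (2 * a).
Proof.
move=> a0; have -> : expR (2 * a) = expR a ^+ 2 by rewrite expRM_natl.
apply: lerXn2r; rewrite ?nnegrE ?expR_ge0//.
by have := expR_ge1Dx a; lra.
Qed.

Lemma expR_le_expr (R : realType) (x y : R) k : 0 < x -> x^-1 <= expR y ->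
  expR (- (k%:R * y)) <= x ^+ k.
Proof.
move=> x0 xy; rewrite -mulrN expRM_natl; apply: lerXn2r; rewrite ?nnegrE ?expR_ge0 ?(ltW x0)//.
by rewrite expRN -[leRHS]invrK lef_pV2// posrE ?expR_gt0 ?invr_gt0.
Qed.

(** With [q] about [n / ln n] vertices on each side, the number of gaining pairs
    has mean at least [n ^ (2 * delta)] up to factors [expR (O (sqrt (ln n)))]; this is
    what makes both the diagonal and the shared-vertex terms of its second
    moment negligible, while [q * kappa <= 1] keeps the inside gain
    probability bounded below. *)
Lemma transposable_prob_lb (R : realType) (B : finType) (g : bool * B -> R)
    (n : nat) (delta : R) :
  (forall v, 0 <= g v) -> \sum_v g v = 1 ->
  0 <= kappa g -> kappa g <= 4^-1 -> 0 < delta -> delta <= 1 ->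
  n%:R * kappa g <= (1 - delta) * (1 - 2 * kappa g) * ln n%:R ->
  20 / delta <= Num.sqrt (ln n%:R) ->
  expR (- 32) / 12 <= Ex g (fun Y : {ffun edge n -> bool * B} => (transposable g Y)%:R).
Proof.
move=> g0 g1; set K := kappa g => K0 K4 d0 d1; set L := ln n%:R => nK; set a := Num.sqrt L => ha.
have a20 : 20 <= a by apply: le_trans ha; rewrite ler_pdivlMr//; nra.
have a0 : 0 < a by lra.
have L0 : 0 < L by rewrite -sqrtr_gt0.
have La : L = a ^+ 2 by rewrite sqr_sqrtr// ltW.
have La20 : 20 * a <= L by rewrite La expr2 ler_pM2r.
have dL : 20 * a <= delta * L.
  by rewrite La expr2 mulrA ler_pM2r// mulrC -ler_pdivrMr.
have n0 : 0 < n%:R :> R.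
  by rewrite ltNge; apply/negP => h; move: L0; rewrite /L ln0// ltxx.
have nE : n%:R = expR L by rewrite lnK.
have LE : L <= expR (2 * a) by rewrite La; apply: le_expR2_sqr; exact: ltW.
have Z0 : 0 < 1 - 2 * K by lra.
have nKL : n%:R * K <= L.
  by apply: (le_trans nK); rewrite ler_piMl ?(ltW L0)// mulr_ile1//; lra.
pose q := Num.truncn (n%:R / L).
have [q_le q_gt] : q%:R <= n%:R / L /\ n%:R / L < q%:R + 1.
  have := truncn_itv (divr_ge0 (ltW n0) (ltW L0)).
  by rewrite natr1 => /andP[].
have nL : expR (L - 2 * a) <= n%:R / L.
  rewrite expRD -nE expRN ler_pM2l// lef_pV2// posrE ?expR_gt0//.
have q_lb : expR (L - 3 * a) <= q%:R.
  have h1 : 2 * expR (L - 3 * a) <= expR (L - 2 * a).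
    have -> : L - 2 * a = a + (L - 3 * a) by ring.
    by rewrite [leRHS]expRD ler_pM2r ?expR_gt0//; have := expR_ge1Dx a; lra.
  have h2 : 1 <= expR (L - 3 * a).
    by rewrite -[leLHS]expR0 ler_expR; clear -La20 a20; lra.
  by clear -h1 h2 nL q_gt; lra.
have q0 : 0 < q%:R :> R by apply: lt_le_trans q_lb; exact: expR_gt0.
have qn : (q + q <= n)%N.
  rewrite -(ler_nat R) natrD; apply: (@le_trans _ _ (2 * (n%:R / L))); first by clear -q_le; lra.
  by rewrite mulrA ler_pdivrMr// mulrC ler_pM2l//; clear -La20 a20; lra.
have qK : q%:R * K <= 1 - 2 * K.
  apply: (@le_trans _ _ (n%:R / L * K)); first exact: ler_wpM2r.
  rewrite mulrAC ler_pdivrMr//; apply: (le_trans nK).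
  by rewrite -mulrA ler_piMl ?mulr_ge0 ?ltW//; clear -d0; lra.
have [S1 _ cS1] : exists2 S : {set 'I_n}, (S \subset [set: 'I_n])%SET & #|S| = q.
  by apply: exists_subset_card; rewrite cardsT card_ord (leq_trans _ qn)// leq_addr.
have [S2 S21 cS2] : exists2 S : {set 'I_n}, (S \subset ~: S1)%SET & #|S| = q.
  by apply: exists_subset_card; rewrite cardsCs finset.setCK cS1 card_ord leq_subRL
    ?(leq_trans _ qn) ?leq_addr.
have S12 : [disjoint S1 & S2].
  by rewrite disjoint_sym finset.disjoints_subset.
have q_gt0 : (0 < q)%N by rewrite -(ltr_nat R).
have [e0 _] : exists e0 : edge n, True.
  have [i iS1] : exists i, i \in S1 by apply/card_gt0P; rewrite cS1.
  have [j jS2] : exists j, j \in S2 by apply/card_gt0P; rewrite cS2.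
  have ij : i != j by apply: contraTneq jS2 => <-; rewrite (disjointFr S12 iS1).
  have ij2 : #|[set i; j]%SET| == 2 by rewrite cards2 ij.
  by exists (exist _ [set i; j]%SET ij2).
pose N := (n - (q + q))%N.
have cO : #|(~: (S1 :|: S2))%SET| = N.
  by rewrite cardsCs finset.setCK cardsU (disjoint_setI0 S12) cards0 subn0 cS1 cS2 card_ord.
have Nn : N%:R <= n%:R :> R by rewrite ler_nat leq_subr.
have := transposable_second_moment g0 g1 e0 S12 cS1 cS2 cO.
set Pr := Ex g _; set P := swap_prob g N; set Phi := swap_prob g _; rewrite -/K.
set T := (1 - 3 * K) ^+ N => second.
have P_lb : (1 - 2 * K) ^+ N * expR (- (6 * a)) / 2 <= P.
  apply: swap_prob_lb => //; first by clear -a0; lra.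
  rewrite -/K exprMn -La; apply: (@le_trans _ _ (16 * ((1 - delta) * (1 - 2 * K) * L))).
    by rewrite -mulrA ler_pM2l// (le_trans _ nK)// ler_wpM2r.
  have : 0 <= (1 - 2 * K) * L by rewrite mulr_ge0// ltW.
  have -> : 6 ^+ 2 * L * (1 - 2 * K) = 36 * ((1 - 2 * K) * L) by ring.
  by rewrite -(mulrA (1 - delta)); move: ((1 - 2 * K) * L) => y y0; clear -d0 y0; nra.
have Phi_lb : expR (- 16) / 2 <= Phi.
  have q2 : (q + q - 2)%:R <= 2 * q%:R :> R.
    by rewrite mulr_natl mulr2n -natrD ler_nat leq_subr.
  have lb : (1 - 2 * K) ^+ (q + q - 2)%N * expR (- 8) / 2 <= Phi.
    apply: swap_prob_lb => //; rewrite -/K.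
    apply: (@le_trans _ _ (16 * (2 * q%:R) * K)).
      by rewrite ler_wpM2r// ler_pM2l.
    have -> : 16 * (2 * q%:R) * K = 32 * (q%:R * K) by ring.
    by rewrite expr2; clear -qK Z0; lra.
  apply: le_trans lb; rewrite ler_pM2r ?invr_gt0//.
  have -> : - 16 = - 8 + - 8 :> R by ring.
  rewrite expRD ler_pM2r ?expR_gt0//.
  apply: (@le_trans _ _ (expR (- ((q + q - 2)%:R * (4 * K))))).
    rewrite ler_expR lerN2; apply: (@le_trans _ _ (2 * q%:R * (4 * K))).
      by rewrite ler_wpM2r// mulr_ge0.
    have -> : 2 * q%:R * (4 * K) = 8 * (q%:R * K) by ring.
    by clear -qK K0; lra.
  apply: expR_le_expr => //; apply: (@le_trans _ _ (1 + 4 * K)); last exact: expR_ge1Dx.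
  by rewrite -[(1 - 2 * K)^-1]mul1r ler_pdivrMr//; clear -K0 K4; nra.
have P0 : 0 < P.
  by apply: lt_le_trans P_lb; rewrite !mulr_gt0 ?exprn_gt0 ?expR_gt0 ?invr_gt0.
have diag : 1 <= q%:R ^+ 2 * P.
  have Zn : expR (- (2 * ((1 - delta) * L))) <= (1 - 2 * K) ^+ N.
    apply: (@le_trans _ _ (expR (- (N%:R * (2 * (K / (1 - 2 * K))))))).
      rewrite ler_expR lerN2 mulrCA ler_pM2l// mulrA ler_pdivrMr//.
      by rewrite mulrAC; apply: le_trans nK; rewrite ler_wpM2r.
    apply: expR_le_expr => //.
    apply: le_trans (expR_ge1Dx _); rewrite le_eqVlt; apply/orP; left; apply/eqP.
    by field; rewrite gt_eqF.
  have q2 : expR (2 * (L - 3 * a)) <= q%:R ^+ 2.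
    by rewrite expRM_natl; apply: lerXn2r; rewrite ?nnegrE ?expR_ge0 ?(ltW q0).
  apply: (@le_trans _ _ (expR (2 * (L - 3 * a)) *
    (expR (- (2 * ((1 - delta) * L))) * expR (- (6 * a)) / 2))); last first.
    apply: ler_pM => //; rewrite ?mulr_ge0 ?expR_ge0 ?invr_ge0//.
    apply: le_trans P_lb; rewrite ler_pM2r ?invr_gt0//.
    by rewrite ler_wpM2r ?expR_ge0.
  rewrite -expRD mulrA -expRD ler_pdivlMr// mul1r.
  have -> : 2 * (L - 3 * a) + (- (2 * ((1 - delta) * L)) + - (6 * a)) =
     2 * (delta * L) - 12 * a by ring.
  by apply: le_trans (expR_ge1Dx _); clear -dL a20; lra.
have shared : 2 * T <= q%:R * P ^+ 2.
  have T_le : T <= ((1 - 2 * K) ^+ N) ^+ 2 * expR ((1 - delta) * L).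
    apply: (@le_trans _ _ (((1 - 2 * K) ^+ 2 * expR K) ^+ N)).
      apply: lerXn2r; rewrite ?nnegrE ?triple_affinity_ge0//.
        by rewrite mulr_ge0 ?expR_ge0// sqr_ge0.
      have /(ler_wpM2l (sqr_ge0 (1 - 2 * K))) := expR_ge1Dx K.
      apply: le_trans; rewrite -subr_ge0.
      have -> : (1 - 2 * K) ^+ 2 * (1 + K) - (1 - 3 * K) = 4 * K ^+ 3 by ring.
      by rewrite mulr_ge0// exprn_ge0.
    have ZN0 : 0 <= (1 - 2 * K) ^+ 2 ^+ N by rewrite exprn_ge0// sqr_ge0.
    rewrite exprMn exprAC ler_wpM2l// -expRM_natl ler_expR.
    apply: (@le_trans _ _ (n%:R * K)); first exact: ler_wpM2r.
    apply: (le_trans nK); rewrite mulrAC ler_piMr//; last by clear -K0; lra.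
    by rewrite mulr_ge0 ?(ltW L0)// subr_ge0.
  have P2 : (((1 - 2 * K) ^+ N) * expR (- (6 * a)) / 2) ^+ 2 <= P ^+ 2.
    apply: lerXn2r; rewrite ?nnegrE ?(ltW P0)//.
    by rewrite !mulr_ge0 ?expR_ge0 ?exprn_ge0 ?invr_ge0// ltW.
  apply: (@le_trans _ _ (expR (L - 3 * a) *
     (((1 - 2 * K) ^+ N) * expR (- (6 * a)) / 2) ^+ 2)); last first.
    by apply: ler_pM; rewrite ?expR_ge0 ?sqr_ge0.
  apply: (@le_trans _ _ (2 * (((1 - 2 * K) ^+ N) ^+ 2 * expR ((1 - delta) * L)))).
    by rewrite ler_pM2l.
  have -> : expR (L - 3 * a) * (((1 - 2 * K) ^+ N) * expR (- (6 * a)) / 2) ^+ 2 =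
     2 * (((1 - 2 * K) ^+ N) ^+ 2 * (expR (L - 15 * a) / 8)).
    have -> : expR (L - 15 * a) = expR (L - 3 * a) * expR (- (6 * a)) ^+ 2.
      by rewrite expr2 -!expRD; congr expR; ring.
    by move: (_ ^+ N) (expR (L - 3 * a)) (expR (- _)) => x y w; field.
  rewrite ler_pM2l// ler_wpM2l ?sqr_ge0// ler_pdivlMr//.
  have -> : L - 15 * a = (1 - delta) * L + (delta * L - 15 * a) by ring.
  rewrite [leRHS]expRD ler_pM2l ?expR_gt0//.
  by apply: le_trans (expR_ge1Dx _); clear -dL a20; lra.
have main : q%:R ^+ 4 * P ^+ 2 * Phi ^+ 2 <= q%:R ^+ 4 * P ^+ 2 * (3 * Pr).
  have Pr0 : 0 <= Pr by apply: Ex_ge0.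
  have -> : q%:R ^+ 4 * P ^+ 2 * Phi ^+ 2 = (q%:R ^+ 2 * (P * Phi)) ^+ 2 by ring.
  apply: (le_trans second).
  have -> : q%:R ^+ 4 * P ^+ 2 * (3 * Pr) =
     Pr * (q%:R ^+ 4 * P ^+ 2 + q%:R ^+ 3 * (q%:R * P ^+ 2) +
           q%:R ^+ 2 * P * (q%:R ^+ 2 * P)) by ring.
  apply: ler_wpM2l => //; apply: lerD.
    rewrite lerD2l [2 * _]mulrC -mulrA ler_pM2l ?exprn_gt0//.
  by rewrite ler_peMr// mulr_ge0 ?sqr_ge0// ltW.
have W0 : 0 < q%:R ^+ 4 * P ^+ 2 by rewrite mulr_gt0 ?exprn_gt0.
move: main; rewrite ler_pM2l// => main.
have Phi2 : (expR (- 16) / 2) ^+ 2 <= Phi ^+ 2.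
  by apply: lerXn2r; rewrite ?nnegrE ?swap_prob_ge0 ?divr_ge0 ?expR_ge0.
have -> : expR (- 32) / 12 = (expR (- 16) / 2) ^+ 2 / 3 :> R.
  have -> : - 32 = - 16 + - 16 :> R by ring.
  by rewrite expRD; field.
by rewrite ler_pdivrMr// [Pr * 3]mulrC (le_trans Phi2).
Qed.

(** * Impossibility *)

Local Open Scope classical_set_scope.
Local Open Scope ring_scope.

Lemma exact_alignment_impossible_below (R : realType) (m : nat) (hm : (2 <= m)%N)
    (p s : nat -> R)
    (hp : forall n : nat, 0 <= p n <= 1)
    (hs : forall n : nat, 0 <= s n <= 1)
    (hps : p n * s n @[n --> \oo] --> (0 : R))
    (eps : R) (heps : 0 < eps) :
  (\forall n \near \oo,
      n%:R * p n * s n * (1 - (1 - s n) ^+ (m - 1)%N)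
        * (1 - Num.sqrt (p n)) ^+ 2 <= (1 - eps) * ln n%:R) ->
  exact_alignment_impossible m p s.
Proof.
case: m hm => [|[|m']]// _; rewrite subn1/= => hnear [est ach].
(* Decreasing eps weakens the hypothesis, because ln n >= 0. *)
pose e := Num.min eps 2^-1.
have e0 : 0 < e by rewrite lt_min heps invr_gt0/=.
have e_eps : e <= eps by rewrite ge_min lexx.
have e2 : e <= 2^-1 by rewrite ge_min lexx orbT.
clearbody e.
(* The slack needed on m * p * s: both kappa and the relative error of the
   exponent are then small compared with e. *)
pose z := (e / 16) ^+ 2.
have z0 : 0 < z by rewrite exprn_gt0// divr_gt0.
have sz : Num.sqrt z = e / 16 by rewrite sqrtr_sqr gtr0_norm// divr_gt0.
have z_e : z <= e / 16 * (1 / 16).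
  by rewrite /z expr2 ler_pM2l ?divr_gt0//; lra.
clearbody z.
have m0 : 0 < m'.+2%:R :> R by rewrite ltr0n.
pose c : R := expR (- 32) / 12.
have c0 : 0 < c by rewrite divr_gt0// expR_gt0.
have key : \forall n \near \oo,
    prob (p n) (s n) (fun w : sample m'.+2 n => ov R (pistar w) (est n (obs w)) == 1)
    <= 1 - c / 2.
  near=> n.
  have below : n%:R * p n * s n * (1 - (1 - s n) ^+ m'.+1)
        * (1 - Num.sqrt (p n)) ^+ 2 <= (1 - eps) * ln n%:R by near: n.
  have ps_small : p n * s n < z / m'.+2%:R.
    near: n; apply: (cvgr_lt 0 hps); exact: divr_gt0.
  have n_large : expR ((40 / e) ^+ 2) <= n%:R by near: n; exact: nbhs_infty_ger.
  have hz : m'.+2%:R * (p n * s n) <= z by rewrite mulrC -ler_pdivlMr// ltW.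
  have ps0 : 0 <= p n * s n.
    by apply: mulr_ge0; [case/andP: (hp n)|case/andP: (hs n)].
  set g := letter_law (m' := m') (p n) (s n).
  have K0 : 0 <= kappa g by exact: kappa_ge0.
  have Kz : kappa g <= z.
    apply: (le_trans (kappa_le m' (hp n) (hs n))); apply: le_trans hz.
    by rewrite ler_peMl// ler1n.
  have L40 : (40 / e) ^+ 2 <= ln n%:R.
    rewrite -ler_expR lnK// posrE; apply: lt_le_trans n_large; exact: expR_gt0.
  have L0 : 0 <= ln n%:R :> R by apply: le_trans L40; exact: sqr_ge0.
  have nK : n%:R * kappa g <= (1 - e / 2) * (1 - 2 * kappa g) * ln n%:R.
    have t1 : z + Num.sqrt z <= 1 by rewrite sz; lra.
    have := kappa_threshold (hp n) (hs n) hz t1.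
    rewrite -/g sz => /(ler_wpM2l (ler0n R n)) thr.
    have {}thr : n%:R * kappa g * (1 - (z + e / 16)) ^+ 2 <= (1 - e) * ln n%:R.
      apply: (@le_trans _ _ ((1 - eps) * ln n%:R)); last by rewrite ler_wpM2r// lerB.
      by apply: le_trans below; rewrite -mulrA (le_trans thr)// !mulrA.
    have sq : 1 - e / 4 <= (1 - (z + e / 16)) ^+ 2.
      by clear -z_e z0 e0 e2; nra.
    have nK0 : 0 <= n%:R * kappa g by rewrite mulr_ge0.
    have h1 : n%:R * kappa g * (1 - e / 4) <= (1 - e) * ln n%:R.
      by apply: le_trans thr; rewrite ler_wpM2l.
    have f1 : 0 < 1 - e / 4 by lra.
    rewrite -(ler_pM2r f1); apply: (le_trans h1).
    rewrite [leRHS]mulrAC ler_wpM2r//.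
    by move: (kappa g) Kz K0 => k kz k0; clear -kz k0 z_e e0 e2; nra.
  have e2' : 0 < e / 2 by rewrite divr_gt0.
  have big : 20 / (e / 2) <= Num.sqrt (ln n%:R).
    have -> : 20 / (e / 2) = 40 / e by field; rewrite gt_eqF.
    have e40 : 0 <= 40 / e by rewrite divr_ge0// ltW.
    by rewrite -(ger0_norm e40) -sqrtr_sqr ler_wsqrtr.
  have g0 v : 0 <= g v by exact: letter_law_ge0.
  have lb : c <= Ex g (fun Y : {ffun edge n -> _} => (transposable g Y)%:R).
    apply: (transposable_prob_lb g0 (letter_law_total m' (p n) (s n)) K0 _ e2' _ nK big).
      by clear -Kz z_e e2; lra.
    by clear -e2; lra.
  have := transposable_le_failure (est n) (hp n) (hs n); rewrite -/g => ub.
  by move: (le_trans lb ub); clear; lra.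
have ev : \forall n \near \oo, 1 - c / 2 <
    prob (p n) (s n) (fun w : sample m'.+2 n => ov R (pistar w) (est n (obs w)) == 1).
  by apply: (cvgr_gt 1 ach); rewrite ltrBlDr ltrDl divr_gt0.
near \oo => n.
have : 1 - c / 2 < 1 - c / 2 by apply: (@lt_le_trans _ _ _ _ _ (near ev n _) (near key n _)).
by rewrite ltxx.
Unshelve. all: by end_near.
Qed.

Theorem corollary6p4 (R : realType) (m : nat) (hm : (2 <= m)%N)
    (p s : nat -> R)
    (hp : forall n : nat, 0 <= p n <= 1)
    (hs : forall n : nat, 0 <= s n <= 1)
    (hps : p n * s n @[n --> \oo] --> (0 : R))
    (eps : R) (heps : 0 < eps) :
  ((\forall n \near \oo,
      n%:R * p n * s n * (1 - (1 - s n) ^+ (m - 1)%N)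
        * (1 - Num.sqrt (p n)) ^+ 2 <= (1 - eps) * ln n%:R) ->
    exact_alignment_impossible m p s) /\
  ((\forall n \near \oo,
      n%:R * p n * s n ^+ 2 * (1 - Num.sqrt (p n)) ^+ 2
        <= (1 - eps) * ln n%:R / (m%:R - 1)) ->
    exact_alignment_impossible m p s).
Proof.
split; first exact: exact_alignment_impossible_below.
move=> near2; apply: (exact_alignment_impossible_below hm hp hs hps heps).
near=> n.
have : n%:R * p n * s n ^+ 2 * (1 - Num.sqrt (p n)) ^+ 2
        <= (1 - eps) * ln n%:R / (m%:R - 1) by near: n.
have m1 : (m - 1)%N%:R = m%:R - 1 :> R by rewrite natrB// (leq_trans _ hm).
have m1_gt0 : 0 < m%:R - 1 :> R by rewrite -m1 ltr0n subn_gt0.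
rewrite ler_pdivlMr//; apply: le_trans.
have := one_minus_expr_le (m - 1) (hs n); rewrite m1 => h.
have [p0 _] := andP (hp n); have [s0 _] := andP (hs n).
have -> : n%:R * p n * s n ^+ 2 * (1 - Num.sqrt (p n)) ^+ 2 * (m%:R - 1) =
   n%:R * p n * s n * ((m%:R - 1) * s n) * (1 - Num.sqrt (p n)) ^+ 2 by ring.
by rewrite ler_wpM2r ?sqr_ge0// ler_wpM2l ?mulr_ge0.
Unshelve. all: by end_near.
Qed.
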